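(* Let $\mathbb{K}$ be an algebraically closed field of characteristic $0$, let $r,s,\gamma\in\mathbb{K}$, and let $A=A(\alpha,\beta,\gamma)$ be the down-up algebra with $\alpha=r+s$ and $\beta=-rs$. Assume that $\beta\neq0$ and that one of $r$ or $s$ is not a root of unity. The group $\mathrm{Aut}_{\mathbb{K}}(A)$ of $\mathbb{K}$-algebra automorphisms of $A$ is described as follows. (a) If $\gamma=0$ and $\beta=-1$ then $\mathrm{Aut}_{\mathbb{K}}(A)\simeq(\mathbb{K}^* )^2\rtimes\mathbb{Z}/2\mathbb{Z}$; (b) If $\gamma=0$ and $\beta\neq-1$ then $\mathrm{Aut}_{\mathbb{K}}(A)\simeq(\mathbb{K}^* )^2$; (c) If $\gamma\neq0$ and $\beta=-1$ then $\mathrm{Aut}_{\mathbb{K}}(A)\simeq\mathbb{K}^*\rtimes\mathbb{Z}/2\mathbb{Z}$; (d) If $\gamma\neq0$ and $\beta\neq-1$ then $\mathrm{Aut}_{\mathbb{K}}(A)\simeq\mathbb{K}^*$. In all cases, the $2$-torus $(\mathbb{K}^* )^2$ (in (a), (b)) acts diagonally on the generators $d$ and $u$ (that is, $(\lambda,\mu)$ acts by $d\mapsto\lambda d$, $u\mapsto\mu u$); $\mu\in\mathbb{K}^*$ (in (c), (d)) acts as multiplication by $\mu$ on $d$ and as multiplication by $\mu^{-1}$ on $u$; and the generator of the finite group $\mathbb{Z}/2\mathbb{Z}$ (in (a), (c)) interchanges $d$ and $u$.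
   Context: The down-up algebra $A(\alpha,\beta,\gamma)$ (Benkart–Roby) is the unital associative $\mathbb{K}$-algebra generated by $d,u$ subject to the relations $d^2u=\alpha\,dud+\beta\,ud^2+\gamma d$ and $du^2=\alpha\,udu+\beta\,u^2d+\gamma u$. $\mathbb{K}^*$ denotes the multiplicative group of nonzero elements of $\mathbb{K}$. Note that $r,s$ are the roots of $X^2-\alpha X-\beta$. *)

(* Defs.v *)
From HB Require Import structures.
From mathcomp Require Import all_boot all_order all_algebra.
From mathcomp Require Import finmap monalg boolp.

Set Implicit Arguments.
Unset Strict Implicit.
Unset Printing Implicit Defensive.

Import GRing.Theory.

Local Open Scope ring_scope.
Local Open Scope quotient_scope.

Definition two_sided_ideal (R : nzRingType) (I : {pred R}) : Prop :=
  zmod_closed I /\ (forall a x b : R, x \in I -> a * x * b \in I).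

Definition ideal_gen (R : nzRingType) (S : seq R) : {pred R} :=
  fun x => `[< forall I : {pred R},
                 two_sided_ideal I -> {subset S <= I} -> x \in I >].

Section IdealGen.
Variables (R : nzRingType) (S : seq R).

Lemma ideal_genP x :
  reflect (forall I : {pred R},
             two_sided_ideal I -> {subset S <= I} -> x \in I)
          (x \in ideal_gen S).
Proof. exact: asboolP. Qed.

Lemma ideal_gen_zmod_closed : zmod_closed (ideal_gen S).
Proof.
split=> [|x y /ideal_genP Ix /ideal_genP Iy]; apply/ideal_genP=> I II SI.
  by case: II.1.
by case: (II.1) => _; apply; [apply: Ix | apply: Iy].
Qed.

HB.instance Definition _ :=
  GRing.isZmodClosed.Build R (ideal_gen S) ideal_gen_zmod_closed.

Lemma ideal_genM a x b : x \in ideal_gen S -> a * x * b \in ideal_gen S.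
Proof.
by move=> /ideal_genP Ix; apply/ideal_genP=> I II SI; apply: II.2; apply: Ix.
Qed.

Lemma mem_ideal_gen x : x \in S -> x \in ideal_gen S.
Proof. by move=> Sx; apply/ideal_genP=> I _; apply. Qed.

End IdealGen.

(* [{fmonom bool}] is the free monoid on two letters, [true] standing for d    *)
(* and [false] for u.                                                         *)
Notation free_alg2 K := {malg K[{fmonom bool}]}.

Definition free_d (K : fieldType) : free_alg2 K := << fmu true >>.
Definition free_u (K : fieldType) : free_alg2 K := << fmu false >>.

Definition down_up_relators (K : fieldType) (alpha beta gamma : K) :
    seq (free_alg2 K) :=
  let d := free_d K in let u := free_u K in
  [:: d ^+ 2 * u - (alpha *: (d * u * d) + beta *: (u * d ^+ 2) + gamma *: d);
      d * u ^+ 2 - (alpha *: (u * d * u) + beta *: (u ^+ 2 * d) + gamma *: u)].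

Definition down_up (K : fieldType) (alpha beta gamma : K) : Type :=
  {ideal_quot ideal_gen (down_up_relators alpha beta gamma)}.

Section DownUp.
Variables (K : fieldType) (alpha beta gamma : K).

Local Notation F := (free_alg2 K).
Local Notation rels := (down_up_relators alpha beta gamma).
Local Notation I := (ideal_gen rels).
Local Notation A := (down_up alpha beta gamma).

HB.instance Definition _ := GRing.Zmodule.on A.

Definition down_up_pi (x : F) : A := \pi_({ideal_quot I}) x.

Local Notation pi := down_up_pi.
Local Notation rpr a := (repr (a : {ideal_quot I})).

Lemma down_up_pi_eq x y : (pi x = pi y) <-> (x - y \in I).
Proof. by rewrite Quotient.idealrBE; split=> /eqP. Qed.

Lemma down_up_reprK (a : A) : pi (rpr a) = a.
Proof. exact: reprK. Qed.

Lemma down_up_pi_surj (a : A) : exists x, a = pi x.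
Proof. by exists (rpr a); rewrite down_up_reprK. Qed.

Fact down_up_pi_is_zmod_morphism : zmod_morphism down_up_pi.
Proof. by move=> x y; rewrite /down_up_pi raddfB. Qed.

HB.instance Definition _ :=
  GRing.isZmodMorphism.Build F A down_up_pi down_up_pi_is_zmod_morphism.

(* The operations are locked to keep unification from unfolding them down to   *)
(* monoid-algebra sums.                                                       *)
Definition down_up_one : A := locked (pi 1).
Definition down_up_mul (a b : A) : A := locked (pi (rpr a * rpr b)).
Definition down_up_scale (c : K) (a : A) : A := locked (pi (c *: rpr a)).

Lemma ideal_repr x : rpr (pi x) - x \in I.
Proof. by apply/down_up_pi_eq; rewrite down_up_reprK. Qed.

Lemma down_up_pi_mul x y : down_up_mul (pi x) (pi y) = pi (x * y).
Proof.
rewrite /down_up_mul -lock.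
apply/down_up_pi_eq.
have -> : rpr (pi x) * rpr (pi y) - x * y
        = 1 * (rpr (pi x) - x) * rpr (pi y) + x * (rpr (pi y) - y) * 1.
  by rewrite mul1r mulr1 mulrBl mulrBr addrA subrK.
by rewrite rpredD // ideal_genM // ideal_repr.
Qed.

Lemma down_up_pi_scale c x : down_up_scale c (pi x) = pi (c *: x).
Proof.
rewrite /down_up_scale -lock.
apply/down_up_pi_eq; rewrite -scalerBr -mul_malgC -[_ * _]mulr1.
by rewrite ideal_genM // ideal_repr.
Qed.

Fact down_up_mulA : associative down_up_mul.
Proof.
move=> a b c; have [x ->] := down_up_pi_surj a.
have [y ->] := down_up_pi_surj b; have [z ->] := down_up_pi_surj c.
by rewrite !down_up_pi_mul mulrA.
Qed.

Fact down_up_mul1 : left_id down_up_one down_up_mul.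
Proof.
by move=> a; have [x ->] := down_up_pi_surj a; rewrite /down_up_one -lock down_up_pi_mul mul1r.
Qed.

Fact down_up_1mul : right_id down_up_one down_up_mul.
Proof.
by move=> a; have [x ->] := down_up_pi_surj a; rewrite /down_up_one -lock down_up_pi_mul mulr1.
Qed.

Fact down_up_mulDl : left_distributive down_up_mul +%R.
Proof.
move=> a b c; have [x ->] := down_up_pi_surj a.
have [y ->] := down_up_pi_surj b; have [z ->] := down_up_pi_surj c.
by rewrite -raddfD !down_up_pi_mul mulrDl raddfD.
Qed.

Fact down_up_mulDr : right_distributive down_up_mul +%R.
Proof.
move=> a b c; have [x ->] := down_up_pi_surj a.
have [y ->] := down_up_pi_surj b; have [z ->] := down_up_pi_surj c.
by rewrite -raddfD !down_up_pi_mul mulrDr raddfD.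
Qed.

(* The augmentation of the free algebra kills the relators, so 1 != 0 in A.   *)
Fact down_up_one_neq0 : down_up_one != 0.
Proof.
rewrite /down_up_one -lock -(raddf0 down_up_pi); apply/eqP => /down_up_pi_eq.
rewrite subr0 => /ideal_genP.
pose J : {pred F} := fun x => x@_(mone : {fmonom bool}) == 0.
have JE x : (x \in J) = (x@_(mone : {fmonom bool}) == 0) by [].
move=> /(_ J); suff [JJ SJ] : two_sided_ideal J /\ {subset rels <= J}.
  by move=> /(_ JJ SJ); rewrite JE mcoeff1 eqxx oner_eq0.
have d0 : (free_d K)@_(mone : {fmonom bool}) = 0.
  by rewrite mcoeffU1; case: eqP => // /(congr1 (@fdeg _)); rewrite fdegU fdeg1.
have u0 : (free_u K)@_(mone : {fmonom bool}) = 0.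
  by rewrite mcoeffU1; case: eqP => // /(congr1 (@fdeg _)); rewrite fdegU fdeg1.
split.
  split; first split=> [|x y].
  - by rewrite JE mcoeff0.
  - by rewrite !JE mcoeffB => /eqP-> /eqP->; rewrite subrr.
  - move=> a x b; rewrite !JE => /eqP x0.
    by rewrite !rmorphM /= x0 mulr0 mul0r.
have cM (x y : F) : (x * y)@_(mone : {fmonom bool}) = x@_mone * y@_mone.
  exact: (rmorphM (mcoeff (mone : {fmonom bool}))).
rewrite /down_up_relators; move: (free_d K) (free_u K) d0 u0 => d u d0 u0.
have cZ c (x : F) : x@_mone = 0 -> (c *: x)@_(mone : {fmonom bool}) = 0.
  by move=> x0; rewrite -mul_malgC (cM c%:MP) x0 mulr0.
have aug (p q r t : F) : p@_mone = 0 -> q@_mone = 0 -> r@_mone = 0 ->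
    t@_mone = 0 -> p - (q + r + t) \in J.
  move=> p0 q0 r0 t0; rewrite JE mcoeffB 2!mcoeffD p0 q0 r0 t0.
  by rewrite !addr0 subr0.
move=> x; rewrite inE mem_seq1 => /orP[] /eqP->; apply: aug;
  try apply: cZ; rewrite ?expr2 //.
all: by rewrite ?cM ?d0 ?u0 ?mulr0 ?mul0r.
Qed.

HB.instance Definition _ := GRing.Zmodule_isNzRing.Build A
  down_up_mulA down_up_mul1 down_up_1mul down_up_mulDl down_up_mulDr
  down_up_one_neq0.

Fact down_up_pi_is_monoid_morphism : monoid_morphism down_up_pi.
Proof. split; first by rewrite [RHS]/GRing.one /= /down_up_one -lock.
by move=> x y; rewrite -down_up_pi_mul. Qed.

HB.instance Definition _ :=
  GRing.isMonoidMorphism.Build F A down_up_pi down_up_pi_is_monoid_morphism.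

Fact down_up_scaleA c1 c2 a :
  down_up_scale c1 (down_up_scale c2 a) = down_up_scale (c1 * c2) a.
Proof.
by have [x ->] := down_up_pi_surj a; rewrite !down_up_pi_scale scalerA.
Qed.

Fact down_up_scale1 : left_id 1 down_up_scale.
Proof.
by move=> a; have [x ->] := down_up_pi_surj a; rewrite down_up_pi_scale scale1r.
Qed.

Fact down_up_scaleDr : right_distributive down_up_scale +%R.
Proof.
move=> c a b; have [x ->] := down_up_pi_surj a.
have [y ->] := down_up_pi_surj b.
by rewrite -raddfD !down_up_pi_scale scalerDr raddfD.
Qed.

Fact down_up_scaleDl a :
  {morph down_up_scale^~ a : c1 c2 / c1 + c2}.
Proof.
move=> c1 c2; have [x ->] := down_up_pi_surj a.
by rewrite /= !down_up_pi_scale scalerDl raddfD.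
Qed.

HB.instance Definition _ := GRing.Zmodule_isLmodule.Build K A
  down_up_scaleA down_up_scale1 down_up_scaleDr down_up_scaleDl.

Fact down_up_pi_is_scalable : scalable down_up_pi.
Proof. by move=> c x; rewrite -down_up_pi_scale. Qed.

HB.instance Definition _ :=
  GRing.isScalable.Build K F A *:%R down_up_pi down_up_pi_is_scalable.

Fact down_up_scaleAl (c : K) (a b : A) : c *: (a * b) = c *: a * b.
Proof.
have [x ->] := down_up_pi_surj a; have [y ->] := down_up_pi_surj b.
by rewrite -rmorphM -!linearZ -rmorphM /= scalerAl.
Qed.

HB.instance Definition _ := GRing.Lmodule_isLalgebra.Build K A down_up_scaleAl.

Lemma free_alg2_mulC (c : K) (x : F) : c%:MP * x = x * c%:MP.
Proof.
rewrite [LHS]fgmulUg [RHS]fgmulgU; apply: eq_bigr => m _.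
by rewrite mul1m mulm1 mulrC.
Qed.

Fact down_up_scaleAr (c : K) (a b : A) : c *: (a * b) = a * (c *: b).
Proof.
have [x ->] := down_up_pi_surj a; have [y ->] := down_up_pi_surj b.
rewrite -rmorphM -!linearZ -rmorphM /= -!mul_malgC.
by rewrite mulrA free_alg2_mulC mulrA.
Qed.

HB.instance Definition _ := GRing.Lalgebra_isAlgebra.Build K A down_up_scaleAr.

Definition down_up_d : A := pi (free_d K).
Definition down_up_u : A := pi (free_u K).

Lemma down_up_rel1 (d := down_up_d) (u := down_up_u) :
  d ^+ 2 * u = alpha *: (d * u * d) + beta *: (u * d ^+ 2) + gamma *: d.
Proof.
have rel : rels`_0 \in I by rewrite mem_ideal_gen // mem_head.
move/down_up_pi_eq: rel; rewrite {}/d {}/u /down_up_d /down_up_u.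
move: (free_d K) (free_u K) => d u.
have gen (B C : lalgType K) (f : {lrmorphism B -> C}) (x y : B) :
    f (x ^+ 2 * y)
      = f (alpha *: (x * y * x) + beta *: (y * x ^+ 2) + gamma *: x) ->
    f x ^+ 2 * f y = alpha *: (f x * f y * f x) + beta *: (f y * f x ^+ 2)
                       + gamma *: f x.
  by rewrite !expr2 !rmorphD /= !linearZ /= !rmorphM.
exact: (gen _ _ down_up_pi).
Qed.

Lemma down_up_rel2 (d := down_up_d) (u := down_up_u) :
  d * u ^+ 2 = alpha *: (u * d * u) + beta *: (u ^+ 2 * d) + gamma *: u.
Proof.
have rel : rels`_1 \in I by rewrite mem_ideal_gen // mem_nth.
move/down_up_pi_eq: rel; rewrite {}/d {}/u /down_up_d /down_up_u.
move: (free_d K) (free_u K) => d u.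
have gen (B C : lalgType K) (f : {lrmorphism B -> C}) (x y : B) :
    f (x * y ^+ 2)
      = f (alpha *: (y * x * y) + beta *: (y ^+ 2 * x) + gamma *: y) ->
    f x * f y ^+ 2 = alpha *: (f y * f x * f y) + beta *: (f y ^+ 2 * f x)
                       + gamma *: f y.
  by rewrite !expr2 !rmorphD /= !linearZ /= !rmorphM.
exact: (gen _ _ down_up_pi).
Qed.

Section UniversalProperty.
Variables (C : algType K) (x y : C).

Definition word_eval (m : {fmonom bool}) : C :=
  \prod_(i <- m) (if i then x else y).

Fact word_eval_is_multiplicative : mmorphism word_eval.
Proof.
split=> [m1 m2|]; first by rewrite /word_eval fmM big_cat.
by rewrite /word_eval fm1 big_nil.
Qed.

HB.instance Definition _ :=
  isMultiplicative.Build {fmonom bool} C word_eval word_eval_is_multiplicative.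

Definition free_eval (g : F) : C := mmap (in_alg C) word_eval g.

Fact free_eval_is_zmod_morphism : zmod_morphism free_eval.
Proof. exact: mmap_is_additive. Qed.

HB.instance Definition _ :=
  GRing.isZmodMorphism.Build F C free_eval free_eval_is_zmod_morphism.

Fact free_eval_is_monoid_morphism : monoid_morphism free_eval.
Proof.
have cm (g : F) (m m' : {fmonom bool}) : GRing.comm (in_alg C g@_m) (word_eval m').
  by rewrite /GRing.comm /= mulr_algl mulr_algr.
by case: (commr_mmap_is_multiplicative cm).
Qed.

HB.instance Definition _ :=
  GRing.isMonoidMorphism.Build F C free_eval free_eval_is_monoid_morphism.

Fact free_eval_is_scalable : scalable free_eval.
Proof. by move=> c g; rewrite /free_eval mmapZ /= mulr_algl. Qed.

HB.instance Definition _ :=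
  GRing.isScalable.Build K F C *:%R free_eval free_eval_is_scalable.

Lemma free_eval_d : free_eval (free_d K) = x.
Proof.
by rewrite /free_eval mmapU /= scale1r mul1r /word_eval fmU big_seq1.
Qed.

Lemma free_eval_u : free_eval (free_u K) = y.
Proof.
by rewrite /free_eval mmapU /= scale1r mul1r /word_eval fmU big_seq1.
Qed.

Hypothesis rel1 :
  x ^+ 2 * y = alpha *: (x * y * x) + beta *: (y * x ^+ 2) + gamma *: x.
Hypothesis rel2 :
  x * y ^+ 2 = alpha *: (y * x * y) + beta *: (y ^+ 2 * x) + gamma *: y.

Lemma free_eval_ideal g : g \in I -> free_eval g = 0.
Proof.
move=> /ideal_genP; pose J : {pred F} := fun g => free_eval g == 0.
have JE z : (z \in J) = (free_eval z == 0) by [].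
move=> /(_ J); suff [JJ SJ] : two_sided_ideal J /\ {subset rels <= J}.
  by move=> /(_ JJ SJ); rewrite JE => /eqP.
split.
  split; first split=> [|a b].
  - by rewrite JE raddf0.
  - by rewrite !JE raddfB /= => /eqP-> /eqP->; rewrite subrr.
  - move=> a z b; rewrite !JE => /eqP z0.
    by rewrite !rmorphM /= z0 mulr0 mul0r.
move=> z; rewrite inE mem_seq1 => Sz; rewrite JE.
move: free_eval_d free_eval_u Sz; move: (free_d K) (free_u K) => d u.
have gen (B : lalgType K) (f : {lrmorphism B -> C}) (d' u' z' : B) :
    f d' = x -> f u' = y ->
    (z' == d' ^+ 2 * u' - (alpha *: (d' * u' * d') + beta *: (u' * d' ^+ 2)
                            + gamma *: d'))
    || (z' == d' * u' ^+ 2 - (alpha *: (u' * d' * u') + beta *: (u' ^+ 2 * d')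
                               + gamma *: u')) ->
    f z' == 0.
  move=> fd fu; move: rel1 rel2; rewrite !expr2 => r1 r2.
  by case/orP=> /eqP->; rewrite rmorphB !rmorphD /= !linearZ /=
    !rmorphM /= ?fd ?fu ?r1 ?r2 subrr.
exact: gen.
Qed.

Definition down_up_eval (a : A) : C := free_eval (rpr a).

Lemma down_up_eval_pi g : down_up_eval (pi g) = free_eval g.
Proof.
apply/eqP; rewrite -subr_eq0 -raddfB; apply/eqP/free_eval_ideal.
exact: ideal_repr.
Qed.

Lemma down_up_universal :
  exists f : {lrmorphism A -> C}, f down_up_d = x /\ f down_up_u = y.
Proof.
have fB : zmod_morphism down_up_eval.
  move=> a b; have [g ->] := down_up_pi_surj a.
  have [h ->] := down_up_pi_surj b.
  by rewrite -raddfB !down_up_eval_pi raddfB.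
have fM : monoid_morphism down_up_eval.
  split=> [|a b]; first by rewrite -(rmorph1 pi) down_up_eval_pi rmorph1.
  have [g ->] := down_up_pi_surj a; have [h ->] := down_up_pi_surj b.
  by rewrite -rmorphM !down_up_eval_pi rmorphM.
have fZ : scalable down_up_eval.
  move=> c a; have [g ->] := down_up_pi_surj a.
  by rewrite -linearZ !down_up_eval_pi linearZ.
pose aM := GRing.isZmodMorphism.Build A C down_up_eval fB.
pose mM := GRing.isMonoidMorphism.Build A C down_up_eval fM.
pose sM := GRing.isScalable.Build K A C *:%R down_up_eval fZ.
pose f : {lrmorphism A -> C} := HB.pack down_up_eval aM mM sM.
exists f; rewrite /f /= /down_up_d /down_up_u !down_up_eval_pi.
by rewrite free_eval_d free_eval_u.
Qed.

End UniversalProperty.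

Lemma down_up_lrmorph_ext (C : algType K) (f g : {lrmorphism A -> C}) :
  f down_up_d = g down_up_d -> f down_up_u = g down_up_u -> f =1 g.
Proof.
move=> fgd fgu a; have [x ->] := down_up_pi_surj a.
have word m : f (pi << m >>) = g (pi << m >>).
  case: m => s; elim: s => [|i s IHs].
    have -> : << FMonom [::] >> = 1 :> F by rewrite -fmoneE.
    by rewrite !rmorph1.
  have -> : << FMonom (i :: s) >> = << fmu i >> * << FMonom s >> :> F.
    rewrite [RHS]fgmulUU mulr1; congr << _ >>.
    by apply/eqP; rewrite fmP fmM fmU.
  rewrite !rmorphM /= IHs; congr (_ * _).
  by case: i.
have mono m : f (pi << x@_m *g m >>) = g (pi << x@_m *g m >>).
  have -> : << x@_m *g m >> = x@_m *: << m >> :> F.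
    by rewrite -mul_malgC [RHS]fgmulUU mulr1 mul1m.
  move: (word m); move: << m >> => z fgz.
  by rewrite down_up_pi_is_scalable !linearZ /= fgz.
rewrite (monalgE x) (raddf_sum down_up_pi) (raddf_sum f) (raddf_sum g).
by apply: eq_bigr => m _; apply: mono.
Qed.

End DownUp.

Record alg_aut (K : fieldType) (A : algType K) := AlgAut {
  alg_aut_val :> {lrmorphism A -> A};
  alg_aut_bij : bijective alg_aut_val
}.

HB.instance Definition _ (K : fieldType) (A : algType K) :=
  gen_eqMixin (alg_aut A).
HB.instance Definition _ (K : fieldType) (A : algType K) :=
  gen_choiceMixin (alg_aut A).

Section AlgAut.
Variables (K : fieldType) (A : algType K).
Implicit Types f g h : alg_aut A.

Lemma alg_autP f g : f =1 g -> f = g.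
Proof.
case: f g => [[f [[f1] [f2] [f3]]] f_bij] [[g [[g1] [g2] [g3]]] g_bij] /= fg.
have {}fg : f = g by apply: funext.
case: g / fg in g1 g2 g3 g_bij *.
case: _ / (Prop_irrelevance f1 g1) in f_bij g_bij *.
case: _ / (Prop_irrelevance f2 g2) in f_bij g_bij *.
case: _ / (Prop_irrelevance f3 g3) in f_bij g_bij *.
by rewrite (Prop_irrelevance f_bij g_bij).
Qed.

Fact id_bijective : bijective (idfun : A -> A).
Proof. by exists idfun. Qed.

Definition alg_aut_one : alg_aut A := AlgAut id_bijective.

Definition alg_aut_mul f g : alg_aut A :=
  @AlgAut K A (f \o g) (bij_comp (alg_aut_bij f) (alg_aut_bij g)).

Lemma alg_aut_inv_subproof f :
  exists g : alg_aut A, cancel f g /\ cancel g f.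
Proof.
have [g fK gK] := alg_aut_bij f.
have gB : zmod_morphism g.
  by move=> a b; apply: (can_inj fK); rewrite raddfB /= !gK.
have gM : monoid_morphism g.
  split=> [|a b]; apply: (can_inj fK); first by rewrite rmorph1 gK.
  by rewrite rmorphM /= !gK.
have gZ : scalable g.
  by move=> c a; apply: (can_inj fK); rewrite linearZ /= !gK.
pose aM := GRing.isZmodMorphism.Build A A g gB.
pose mM := GRing.isMonoidMorphism.Build A A g gM.
pose sM := GRing.isScalable.Build K A A *:%R g gZ.
pose g' : {lrmorphism A -> A} := HB.pack g aM mM sM.
have g'_bij : bijective g' by exists f.
by exists (AlgAut g'_bij).
Qed.

Definition alg_aut_inv f : alg_aut A := projT1 (cid (alg_aut_inv_subproof f)).

Lemma alg_autK f : cancel f (alg_aut_inv f).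
Proof. by rewrite /alg_aut_inv; case: cid => g []. Qed.

Lemma alg_autVK f : cancel (alg_aut_inv f) f.
Proof. by rewrite /alg_aut_inv; case: cid => g []. Qed.

Fact alg_aut_mulA : associative alg_aut_mul.
Proof. by move=> f g h; apply: alg_autP. Qed.

Fact alg_aut_mul1 : left_id alg_aut_one alg_aut_mul.
Proof. by move=> f; apply: alg_autP. Qed.

Fact alg_aut_1mul : right_id alg_aut_one alg_aut_mul.
Proof. by move=> f; apply: alg_autP. Qed.

Fact alg_aut_mulV : left_inverse alg_aut_one alg_aut_inv alg_aut_mul.
Proof. by move=> f; apply: alg_autP => a; apply: alg_autK. Qed.

Fact alg_aut_Vmul : right_inverse alg_aut_one alg_aut_inv alg_aut_mul.
Proof. by move=> f; apply: alg_autP => a; apply: alg_autVK. Qed.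

HB.instance Definition _ := isGroup.Build (alg_aut A)
  alg_aut_mulA alg_aut_mul1 alg_aut_1mul alg_aut_mulV alg_aut_Vmul.

Lemma alg_autM f g a : (f * g)%g a = f (g a).
Proof. by []. Qed.

End AlgAut.

Record nonzero (K : fieldType) :=
  Nonzero { nonzero_val : K; nonzero_valP : nonzero_val != 0 }.

HB.instance Definition _ (K : fieldType) := [isSub for @nonzero_val K].
HB.instance Definition _ (K : fieldType) := [Choice of nonzero K by <:].

Section NonzeroGroup.
Variable K : fieldType.
Implicit Types x y z : nonzero K.

Definition nonzero_one : nonzero K := Nonzero (oner_neq0 K).

Definition nonzero_mul x y : nonzero K :=
  Nonzero (mulf_neq0 (nonzero_valP x) (nonzero_valP y)).

Definition nonzero_inv x : nonzero K := Nonzero (invr_neq0 (nonzero_valP x)).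

Fact nonzero_mulA : associative nonzero_mul.
Proof. by move=> x y z; apply: val_inj; rewrite /= mulrA. Qed.

Fact nonzero_mulC : commutative nonzero_mul.
Proof. by move=> x y; apply: val_inj; rewrite /= mulrC. Qed.

Fact nonzero_mul1 : left_id nonzero_one nonzero_mul.
Proof. by move=> x; apply: val_inj; rewrite /= mul1r. Qed.

Fact nonzero_1mul : right_id nonzero_one nonzero_mul.
Proof. by move=> x; apply: val_inj; rewrite /= mulr1. Qed.

Fact nonzero_mulV : left_inverse nonzero_one nonzero_inv nonzero_mul.
Proof.
by move=> x; apply: val_inj; rewrite /= mulVf // nonzero_valP.
Qed.

Fact nonzero_Vmul : right_inverse nonzero_one nonzero_inv nonzero_mul.
Proof.
by move=> x; apply: val_inj; rewrite /= mulfV // nonzero_valP.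
Qed.

HB.instance Definition _ := isGroup.Build (nonzero K)
  nonzero_mulA nonzero_mul1 nonzero_1mul nonzero_mulV nonzero_Vmul.

End NonzeroGroup.

(* Left action of H on N by group automorphisms; in [semidirect theta],        *)
(* (n, h) * (n', h') = (n * theta h n', h * h').                              *)
Record group_action (H N : groupType) := GroupAction {
  gact :> H -> N -> N;
  gactM : forall h, {morph gact h : x y / (x * y)%g};
  gact1 : forall x, gact 1%g x = x;
  gact_comp : forall h k x, gact (h * k)%g x = gact h (gact k x)
}.

Record semidirect (H N : groupType) (theta : group_action H N) :=
  Semidirect { sd_normal : N; sd_compl : H }.

Section SemidirectGroup.
Variables (H N : groupType) (theta : group_action H N).
Local Notation G := (semidirect theta).
Implicit Types x y z : G.

Definition sd_pair x := (sd_normal x, sd_compl x).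
Definition sd_unpair (p : N * H) : G := Semidirect theta p.1 p.2.

Fact sd_pairK : cancel sd_pair sd_unpair.
Proof. by case. Qed.

HB.instance Definition _ := Choice.copy G (can_type sd_pairK).

Definition sd_one : G := Semidirect theta 1%g 1%g.

Definition sd_mul x y : G :=
  Semidirect theta (sd_normal x * theta (sd_compl x) (sd_normal y))%g
                   (sd_compl x * sd_compl y)%g.

Definition sd_inv x : G :=
  Semidirect theta (theta (sd_compl x)^-1 (sd_normal x)^-1)%g
                   (sd_compl x)^-1%g.

Lemma gact_1 h : theta h 1%g = 1%g.
Proof.
by apply: (@mulgI _ (theta h 1%g)); rewrite -gactM !mulg1.
Qed.

Fact sd_mulA : associative sd_mul.
Proof.
by move=> x y z; rewrite /sd_mul /= gactM gact_comp !mulgA.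
Qed.

Fact sd_mul1 : left_id sd_one sd_mul.
Proof. by case=> n h; rewrite /sd_mul /= gact1 !mul1g. Qed.

Fact sd_1mul : right_id sd_one sd_mul.
Proof. by case=> n h; rewrite /sd_mul /= gact_1 !mulg1. Qed.

Fact sd_mulV : left_inverse sd_one sd_inv sd_mul.
Proof.
by case=> n h; rewrite /sd_mul /sd_inv /= -gactM !mulVg gact_1.
Qed.

Fact sd_Vmul : right_inverse sd_one sd_inv sd_mul.
Proof.
by case=> n h; rewrite /sd_mul /sd_inv /= -gact_comp mulgV gact1 mulgV.
Qed.

HB.instance Definition _ := isGroup.Build G
  sd_mulA sd_mul1 sd_1mul sd_mulV sd_Vmul.

Definition sd_inl (n : N) : G := Semidirect theta n 1%g.
Definition sd_inr (h : H) : G := Semidirect theta 1%g h.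

End SemidirectGroup.

Section InvolutionAction.
Variables (N : groupType) (iota : N -> N).
Hypothesis iotaM : {morph iota : x y / (x * y)%g}.
Hypothesis iotaK : involutive iota.

(* The group law of ['Z_2] as a [groupType] is addition, with generator       *)
(* [1%R].                                                                     *)
Definition invol_fun (h : 'Z_2) (x : N) : N := if h == 0 then x else iota x.

Fact invol_funM h : {morph invol_fun h : x y / (x * y)%g}.
Proof. by move=> x y; rewrite /invol_fun; case: ifP. Qed.

Fact invol_fun1 x : invol_fun 1%g x = x.
Proof. by []. Qed.

Fact invol_fun_comp h k x :
  invol_fun (h * k)%g x = invol_fun h (invol_fun k x).
Proof.
by rewrite /invol_fun; case: h k => [[|[|//]] ?] [[|[|//]] ?]; rewrite ?iotaK.
Qed.

Definition invol_action : group_action 'Z_2 N :=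
  GroupAction invol_funM invol_fun1 invol_fun_comp.

End InvolutionAction.

Section TorusActions.
Variable K : fieldType.

Definition torus_swap (t : nonzero K * nonzero K) := (t.2, t.1).

Fact torus_swapM : {morph torus_swap : x y / (x * y)%g}.
Proof. by []. Qed.

Fact torus_swapK : involutive torus_swap.
Proof. by case. Qed.

Definition swap_action : group_action 'Z_2 (nonzero K * nonzero K)%type :=
  invol_action torus_swapM torus_swapK.

Fact nonzero_invM : {morph (fun x : nonzero K => x^-1%g) : x y / (x * y)%g}.
Proof. by move=> x y; apply: val_inj; rewrite /= invfM. Qed.

Definition inv_action : group_action 'Z_2 (nonzero K) :=
  invol_action nonzero_invM (@invgK (nonzero K)).

End TorusActions.

Definition is_root_of_unity (K : fieldType) (z : K) : Prop :=
  exists2 n : nat, (0 < n)%N & n.-unity_root z.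

(* Main.v *)
(* Say r is not a root of unity. With y = du - s ud + gamma/(r-1) one has dy  *)

(* The algebra is a generalized Weyl algebra over [R] = K[y, x] with automorphism [sigma]: [x]
   stands for ud, [sigma x] for du, and d p = sigma(p) d. Letting d and u act on [R] itself
   ([op_relations]) shows that every degree is free of rank one over [R] ([evdu_dupow_eq0]). As r is
   not a root of unity, the factors r^n picked up in passing [yelt] separate the degrees
   ([hsum_indep]), so extreme components are unique, and they multiply ([leading_uniq], [leadingM]).

   Let f be an automorphism with inverse g, and v = [dupow m]. Since [yelt] is normal, so is w =
   g(yelt), and [gr_left], [gr_right] give w v = p v w and v w = w q v with p and q in [R]. Hence w
   = p w q, and comparing extreme components makes p a unit of [R], that is, a scalar
   ([twist_unit]). Applying f, f(v) commutes with [yelt] up to a scalar, so it is homogeneous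
   ([eigen_gr], [aut_gr]).

   A homogeneous right factor of d of nonzero degree is a multiple of d, and likewise for u
   ([irreducible_d], [irreducible_u]). Applied to d = f(g(d)) and u = f(g(u)), this shows that f
   rescales d and u or exchanges them up to scalars ([aut_generators]). The relations then restrict
   the scalars ([diag_gamma], [swap_beta]), the remaining candidates do exist ([scale_aut],
   [swap_aut]), and [alg_aut_group] reads off the group. *)
(* = r yd and yu = r uy, so conjugation by y acts on the degree-n part of     *)
(* the Z-grading deg d = 1, deg u = -1 by r^-n and determines the grading.    *)
(* Each homogeneous part is free of rank one over the polynomial ring K[ud,   *)
(* y], generated by a power of d or of u, and the algebra is a domain. For    *)
(* an automorphism f, w = f(y) is normal. Comparing the extreme degrees of    *)
(* wd = d'w and dw = wd'' shows that d' and d'' are homogeneous of degree 1,  *)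
(* then that they are scalar multiples of d; so d, and likewise u, is an      *)
(* eigenvector of conjugation by w, that is, f^-1(d) and f^-1(u) are          *)
(* homogeneous. The same holds for f, and the degrees have opposite signs by  *)
(* surjectivity. Finally d = f(f^-1(d)) is a multiple of f(d) or of f(u),     *)
(* and d is irreducible, so f(d) or f(u) is a scalar multiple of d; the same  *)
(* goes for u. Hence f rescales d and u or swaps them up to scalars, and the  *)
(* relations decide which of these are automorphisms.                         *)
Require Import Defs.
From HB Require Import structures.
From mathcomp Require Import all_boot all_order all_algebra.
From mathcomp Require Import finmap monalg boolp.
From mathcomp Require Import ring zify.

Set Implicit Arguments.
Unset Strict Implicit.
Unset Printing Implicit Defensive.

Import GRing.Theory.

Local Open Scope ring_scope.

(** * Linear operators *)

Section LinearOperators.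
Variables (K B : comNzRingType) (kappa : {rmorphism K -> B}).

(** Endomorphisms of [B], linear over [K] through [kappa], form a [K]-algebra; this is the kind of
    target that the universal property of a down-up algebra asks for. *)
Record linop := LinOp {
  linop_fun :> B -> B;
  linop_zmod : zmod_morphism linop_fun;
  linop_scale : forall c x, linop_fun (kappa c * x) = kappa c * linop_fun x
}.

HB.instance Definition _ := gen_eqMixin linop.
HB.instance Definition _ := gen_choiceMixin linop.

Lemma linopP (f g : linop) : f =1 g -> f = g.
Proof.
case: f g => [f f1 f2] [g g1 g2] /= fg.
have {}fg : f = g by apply: funext.
case: g / fg in g1 g2 *.
by rewrite (Prop_irrelevance f1 g1) (Prop_irrelevance f2 g2).
Qed.

HB.instance Definition _ (f : linop) :=
  GRing.isZmodMorphism.Build B B f (linop_zmod f).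

#[local] Obligation Tactic := idtac.

Program Definition linop0 := @LinOp (fun _ => 0) _ _.
Next Obligation. by move=> x y; rewrite subrr. Qed.
Next Obligation. by move=> c x; rewrite mulr0. Qed.

Definition linop1 := @LinOp idfun (fun _ _ => erefl) (fun _ _ => erefl).

Program Definition linop_opp (f : linop) := @LinOp (fun x => - f x) _ _.
Next Obligation. by move=> f x y; rewrite raddfB opprD. Qed.
Next Obligation. by move=> f c x; rewrite /= !linop_scale mulrN. Qed.

Program Definition linop_add (f g : linop) := @LinOp (fun x => f x + g x) _ _.
Next Obligation. by move=> f g x y; rewrite !raddfB addrACA opprD. Qed.
Next Obligation. by move=> f g c x; rewrite /= !linop_scale mulrDr. Qed.

Program Definition linop_mul (f g : linop) := @LinOp (f \o g) _ _.
Next Obligation. by move=> f g x y; rewrite /= !raddfB. Qed.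
Next Obligation. by move=> f g c x; rewrite /= !linop_scale. Qed.

Program Definition linop_scaleby (a : K) (f : linop) :=
  @LinOp (fun x => kappa a * f x) _ _.
Next Obligation. by move=> a f x y; rewrite raddfB mulrBr. Qed.
Next Obligation. by move=> a f c x; rewrite /= !linop_scale mulrCA. Qed.

Fact linop_addA : associative linop_add.
Proof. by move=> f g h; apply: linopP => x /=; rewrite addrA. Qed.
Fact linop_addC : commutative linop_add.
Proof. by move=> f g; apply: linopP => x /=; rewrite addrC. Qed.
Fact linop_add0 : left_id linop0 linop_add.
Proof. by move=> f; apply: linopP => x /=; rewrite add0r. Qed.
Fact linop_addN : left_inverse linop0 linop_opp linop_add.
Proof. by move=> f; apply: linopP => x /=; rewrite addNr. Qed.

HB.instance Definition _ := GRing.isZmodule.Build linop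
  linop_addA linop_addC linop_add0 linop_addN.

Fact linop_mulA : associative linop_mul.
Proof. by move=> f g h; apply: linopP. Qed.
Fact linop_mul1 : left_id linop1 linop_mul.
Proof. by move=> f; apply: linopP. Qed.
Fact linop_1mul : right_id linop1 linop_mul.
Proof. by move=> f; apply: linopP. Qed.
Fact linop_mulDl : left_distributive linop_mul +%R.
Proof. by move=> f g h; apply: linopP. Qed.
Fact linop_mulDr : right_distributive linop_mul +%R.
Proof. by move=> f g h; apply: linopP => x /=; rewrite raddfD. Qed.
Fact linop_one_neq0 : linop1 != 0.
Proof.
by apply/eqP => /(congr1 (@linop_fun^~ 1)) /= /eqP; rewrite oner_eq0.
Qed.

HB.instance Definition _ := GRing.Zmodule_isNzRing.Build linop
  linop_mulA linop_mul1 linop_1mul linop_mulDl linop_mulDr linop_one_neq0.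

Fact linop_scaleA a b f :
  linop_scaleby a (linop_scaleby b f) = linop_scaleby (a * b) f.
Proof. by apply: linopP => x /=; rewrite rmorphM mulrA. Qed.
Fact linop_scale1 : left_id 1 linop_scaleby.
Proof. by move=> f; apply: linopP => x /=; rewrite rmorph1 mul1r. Qed.
Fact linop_scaleDr : right_distributive linop_scaleby +%R.
Proof. by move=> a f g; apply: linopP => x /=; rewrite mulrDr. Qed.
Fact linop_scaleDl f : {morph linop_scaleby^~ f : a b / a + b}.
Proof. by move=> a b; apply: linopP => x /=; rewrite rmorphD mulrDl. Qed.

HB.instance Definition _ := GRing.Zmodule_isLmodule.Build K linop
  linop_scaleA linop_scale1 linop_scaleDr linop_scaleDl.

Fact linop_scaleAl (c : K) (f g : linop) : c *: (f * g) = c *: f * g.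
Proof. by apply: linopP. Qed.
HB.instance Definition _ := GRing.Lmodule_isLalgebra.Build K linop
  linop_scaleAl.
Fact linop_scaleAr (c : K) (f g : linop) : c *: (f * g) = f * (c *: g).
Proof. by apply: linopP => x; rewrite /= [RHS]linop_scale. Qed.
HB.instance Definition _ := GRing.Lalgebra_isAlgebra.Build K linop
  linop_scaleAr.

Lemma linopD (f g : linop) x : (f + g) x = f x + g x. Proof. by []. Qed.
Lemma linopM (f g : linop) x : (f * g) x = f (g x). Proof. by []. Qed.
Lemma linopZ c (f : linop) x : (c *: f) x = kappa c * f x. Proof. by []. Qed.

End LinearOperators.

(** * Polynomials in two variables *)

(* The polynomial ring [K[y, x]] is presented by its universal property:      *)
(* with the concrete nested polynomials unification becomes too slow.         *)
Record bivariate (K : fieldType) := Bivariate {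
  biv_ring :> idomainType;
  bivC : {rmorphism K -> biv_ring};
  biv_y : biv_ring;
  biv_x : biv_ring;
  biv_ind : forall P : biv_ring -> Prop,
    (forall c, P (bivC c)) -> P biv_y -> P biv_x ->
    (forall p q, P p -> P q -> P (p + q)) ->
    (forall p q, P p -> P q -> P (p * q)) -> forall p, P p;
  biv_eval : forall (B : nzRingType) (kappa : {rmorphism K -> B}) (y x : B),
    commr_rmorph kappa y -> commr_rmorph kappa x -> GRing.comm x y ->
    {f : {rmorphism biv_ring -> B} |
      (forall c, f (bivC c) = kappa c) /\ f biv_y = y /\ f biv_x = x};
  biv_unit : forall p q : biv_ring, p * q = 1 -> exists c, p = bivC c
}.

Arguments biv_eval {K} b {B kappa y x}.

Section PolyPoly.
Variable K : fieldType.
Local Notation R := {poly {poly K}}.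

Fact poly2_ind (P : R -> Prop) :
  (forall c, P c%:P%:P) -> P 'Y -> P 'X ->
  (forall p q, P p -> P q -> P (p + q)) ->
  (forall p q, P p -> P q -> P (p * q)) -> forall p, P p.
Proof.
move=> PC Py PX PD PM; have P0 : P 0 by exact: PC 0.
elim/poly_ind => [//|p c Pp]; apply: (PD); first by apply: (PM).
elim/poly_ind: c => [//|q c Pq].
by rewrite polyCD polyCM; apply: (PD); [apply: (PM) | exact: PC].
Qed.

Fact poly2_eval (B : nzRingType) (kappa : {rmorphism K -> B}) (y x : B) :
  commr_rmorph kappa y -> commr_rmorph kappa x -> GRing.comm x y ->
  {f : {rmorphism R -> B} |
    (forall c, f c%:P%:P = kappa c) /\ f 'Y = y /\ f 'X = x}.
Proof.
move=> cy cx cxy.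
have comm2 : commr_rmorph (horner_morph cy) x.
  elim/poly_ind => [|p c IHp]; first by rewrite rmorph0; apply: commr0.
  rewrite rmorphD rmorphM /= horner_morphX horner_morphC.
  by apply: commrD => //; apply: commrM.
exists (horner_morph comm2); split; last split.
- move=> c; exact: etrans (horner_morphC _ _) (horner_morphC _ _).
- exact: etrans (horner_morphC _ _) (horner_morphX _).
- exact: horner_morphX.
Qed.

Fact poly2_unit (p q : R) : p * q = 1 -> exists c, p = c%:P%:P.
Proof.
move=> pq1; have : p \is a GRing.unit by apply/unitrP; exists q; rewrite mulrC.
rewrite poly_unitE => /andP[/size_poly1P[c _ ->]].
by rewrite coefC poly_unitE => /andP[/size_poly1P[a _ ->] _]; exists a.
Qed.

Definition poly2_bivariate : bivariate K :=
  @Bivariate K R (polyC \o polyC) 'Y 'X poly2_ind poly2_eval poly2_unit.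
End PolyPoly.

(** * Down-up algebras as free modules *)

Definition down_up_relations (K : fieldType) (alpha beta gamma : K)
    (A : algType K) (d u : A) : Prop :=
  d ^+ 2 * u = alpha *: (d * u * d) + beta *: (u * d ^+ 2) + gamma *: d /\
  d * u ^+ 2 = alpha *: (u * d * u) + beta *: (u ^+ 2 * d) + gamma *: u.

(* [down_up] through its universal property: reasoning in an abstract algebra *)
(* keeps unification away from the quotient construction.                     *)
Record presents_down_up (K : fieldType) (alpha beta gamma : K)
    (A : algType K) (d u : A) : Prop := PresentsDownUp {
  du_rel : down_up_relations alpha beta gamma d u;
  du_univ : forall (C : algType K) (x y : C),
    down_up_relations alpha beta gamma x y ->
    exists f : {lrmorphism A -> C}, f d = x /\ f u = y;
  du_ind : forall P : A -> Prop,
    (forall c, P c%:A) -> P d -> P u ->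
    (forall a b, P a -> P b -> P (a + b)) ->
    (forall a b, P a -> P b -> P (a * b)) -> forall a, P a
}.

Section DownUpPresentation.
Variables (K : fieldType) (alpha beta gamma : K).
Local Notation A := (down_up alpha beta gamma).
Local Notation pi := (@down_up_pi K alpha beta gamma).

Lemma down_up_presented : presents_down_up alpha beta gamma
  (down_up_d alpha beta gamma) (down_up_u alpha beta gamma).
Proof.
split; first by split; [exact: down_up_rel1 | exact: down_up_rel2].
  by move=> C x y [rel1 rel2]; exact: down_up_universal.
move=> P Pc Pd Pu PD PM a; have [g ->] := down_up_pi_surj a.
have word m : P (pi << m >>).
  case: m => w; elim: w => [|i w IHw].
    have -> : << FMonom [::] >> = 1 :> free_alg2 K by rewrite -fmoneE.
    by rewrite rmorph1 -(scale1r 1); apply: Pc.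
  have -> : << FMonom (i :: w) >> = << fmu i >> * << FMonom w >> :> free_alg2 K.
    rewrite [RHS]fgmulUU mulr1; congr << _ >>.
    by apply/eqP; rewrite fmP fmM fmU.
  by rewrite rmorphM; apply: (PM); [case: i | exact: IHw].
have mono m : P (pi << g@_m *g m >>).
  have -> : << g@_m *g m >> = g@_m *: << m >> :> free_alg2 K.
    by rewrite -mul_malgC [RHS]fgmulUU mulr1 mul1m.
  by rewrite down_up_pi_is_scalable -mulr_algl; apply: PM.
rewrite (monalgE g) (raddf_sum pi); elim/big_ind: _ => [||m _].
- by rewrite -(scale0r 1); apply: Pc.
- exact: PD.
- exact: mono.
Qed.
End DownUpPresentation.

Section Structure.
Variables (K : fieldType) (R : bivariate K) (r s gamma c0 : K).
Hypotheses (r_neq0 : r != 0) (s_neq0 : s != 0).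
Hypothesis r_not_root : ~ is_root_of_unity r.
Hypothesis gamma_c0 : gamma + c0 = r * c0.

Variables (A : algType K) (d u : A).
Hypothesis duA : presents_down_up (r + s) (- (r * s)) gamma d u.

Local Notation y := (biv_y R).
Local Notation x := (biv_x R).
Local Notation kap := (bivC R).

Lemma expr_r_neq1 n : (0 < n)%N -> r ^+ n != 1.
Proof.
move=> n0; apply/eqP => rn; apply: r_not_root.
by exists n => //; apply/unity_rootP.
Qed.

(** Conjugation by d, written on polynomials: with [x] for ud and [y] for du - s ud + c0, the image
    of [x] is the polynomial that represents du. *)
Definition sigma_spec := biv_eval R (kappa := kap)
  (fun c => mulrC (kap r * y) (kap c))
  (fun c => mulrC (y + kap s * x - kap c0) (kap c)) (mulrC _ _).
Definition sigma := sval sigma_spec.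

Definition sigma'_spec := biv_eval R (kappa := kap)
  (fun c => mulrC (kap r^-1 * y) (kap c))
  (fun c => mulrC (kap s^-1 * (x - kap r^-1 * y + kap c0)) (kap c))
  (mulrC _ _).
Definition sigma' := sval sigma'_spec.

Lemma sigmaC c : sigma (kap c) = kap c.
Proof. exact: (svalP sigma_spec).1. Qed.
Lemma sigmay : sigma y = kap r * y.
Proof. exact: (svalP sigma_spec).2.1. Qed.
Lemma sigmaX : sigma x = y + kap s * x - kap c0.
Proof. exact: (svalP sigma_spec).2.2. Qed.
Lemma sigma'C c : sigma' (kap c) = kap c.
Proof. exact: (svalP sigma'_spec).1. Qed.
Lemma sigma'y : sigma' y = kap r^-1 * y.
Proof. exact: (svalP sigma'_spec).2.1. Qed.
Lemma sigmax : sigma' x = kap s^-1 * (x - kap r^-1 * y + kap c0).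
Proof. exact: (svalP sigma'_spec).2.2. Qed.

Lemma kap_mulVK c p : c != 0 -> kap c * (kap c^-1 * p) = p.
Proof. by move=> c_neq0; rewrite mulrA -rmorphM mulfV // rmorph1 mul1r. Qed.
Lemma kap_mulKV c p : c != 0 -> kap c^-1 * (kap c * p) = p.
Proof. by move=> c_neq0; rewrite mulrA -rmorphM mulVf // rmorph1 mul1r. Qed.

Lemma sigmaK : cancel sigma sigma'.
Proof.
elim/biv_ind => [c|||p q Hp Hq|p q Hp Hq].
- by rewrite sigmaC sigma'C.
- by rewrite sigmay rmorphM sigma'C sigma'y kap_mulVK.
- rewrite sigmaX rmorphB rmorphD rmorphM !sigma'C sigma'y sigmax kap_mulVK //.
  by ring.
- by rewrite !rmorphD Hp Hq.
- by rewrite !rmorphM Hp Hq.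
Qed.

Lemma sigma'K : cancel sigma' sigma.
Proof.
elim/biv_ind => [c|||p q Hp Hq|p q Hp Hq].
- by rewrite sigma'C sigmaC.
- by rewrite sigma'y rmorphM sigmaC sigmay kap_mulKV.
- rewrite sigmax rmorphM rmorphD rmorphB rmorphM !sigmaC sigmay sigmaX.
  by rewrite kap_mulKV // -[RHS](kap_mulKV _ s_neq0); congr (_ * _); ring.
- by rewrite !rmorphD Hp Hq.
- by rewrite !rmorphM Hp Hq.
Qed.

(** The first defining relation in polynomial form: d^2u, dud and ud^2 are [sigma (sigma x)],
    [sigma x] and [x], each followed by d. *)
Lemma sigmaXX : sigma (sigma x)
  = kap (r + s) * sigma x - kap (r * s) * x + kap gamma.
Proof.
have g : kap gamma = kap r * kap c0 - kap c0.
  by rewrite -rmorphM -gamma_c0 rmorphD addrK.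
have -> : sigma (sigma x) = kap r * y + kap s * sigma x - kap c0.
  by rewrite {1}sigmaX rmorphB rmorphD rmorphM !sigmaC sigmay.
by rewrite g sigmaX [kap (_ + _)]rmorphD [kap (_ * _)]rmorphM; ring.
Qed.

(* The representation of [A] on [R] that shows [evdu R * dupow n] to be free. *)
Local Notation L := (linop kap).

Fact op_d_scale c p : sigma (kap c * p) = kap c * sigma p.
Proof. by rewrite rmorphM sigmaC. Qed.
Definition op_d : L := @LinOp _ _ _ sigma (rmorphB sigma) op_d_scale.

Fact op_u_zmod : zmod_morphism (fun p : R => x * sigma' p).
Proof. by move=> p q; rewrite rmorphB mulrBr. Qed.
Fact op_u_scale c p : x * sigma' (kap c * p) = kap c * (x * sigma' p).
Proof. by rewrite rmorphM sigma'C mulrCA. Qed.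
Definition op_u : L :=
  @LinOp _ _ _ (fun p : R => x * sigma' p) op_u_zmod op_u_scale.

Fact op_relations : down_up_relations (r + s) (- (r * s)) gamma op_d op_u.
Proof.
split; apply: linopP => p.
  rewrite !(linopD, linopZ, linopM, expr2) /=.
  rewrite ![sigma (_ * _)]rmorphM sigmaXX !sigma'K !sigmaK [kap (- _)]rmorphN;
    ring.
rewrite !(linopD, linopZ, linopM, expr2) /=.
(* The second relation is the same recurrence shifted back by [sigma']. *)
have XX : sigma x = kap (r + s) * x - kap (r * s) * sigma' x + kap gamma.
  rewrite -[LHS]sigmaK sigmaXX rmorphD rmorphB ![sigma' (_ * _)]rmorphM.
  by rewrite !sigma'C sigmaK.
rewrite [sigma (_ * _)]rmorphM !sigma'K !sigmaK [sigma' (_ * _)]rmorphM XX.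
rewrite [kap (- _)]rmorphN [kap (_ * _)]rmorphM; ring.
Qed.

(** * Polynomial coefficients inside the algebra *)

Lemma du_rel1 : d * d * u
  = (r + s) *: (d * u * d) - (r * s) *: (u * d * d) + gamma *: d.
Proof.
by have [rel _] := du_rel duA; rewrite -expr2 rel scaleNr expr2 mulrA.
Qed.

Lemma du_rel2 : d * u * u
  = (r + s) *: (u * d * u) - (r * s) *: (u * u * d) + gamma *: u.
Proof. by have [_ rel] := du_rel duA; rewrite -mulrA -expr2 rel scaleNr expr2.
  Qed.

(** Expanding u(ddu) by the first relation and (duu)d by the second gives the same three terms. *)
Lemma du_ud_comm : (u * d) * (d * u) = (d * u) * (u * d).
Proof.
rewrite [RHS]mulrA du_rel2 -mulrA [d * (d * u)]mulrA du_rel1.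
rewrite !(mulrDr, mulrDl) !(mulrN, mulNr) -!(scalerAl, scalerAr).
by rewrite !mulrA.
Qed.

(** The shift by [c0] absorbs the gamma terms of the relations, so that this element commutes with d
    and u exactly up to a factor r. *)
Definition yelt : A := locked (d * u - s *: (u * d) + c0%:A).

Lemma yeltE : yelt = d * u - s *: (u * d) + c0%:A.
Proof. by rewrite /yelt -lock. Qed.

Lemma in_alg_comm (a : A) : commr_rmorph (in_alg A) a.
Proof. by move=> c; rewrite /GRing.comm /= mulr_algl mulr_algr. Qed.

Fact ud_yelt_comm : GRing.comm (u * d) yelt.
Proof.
rewrite yeltE; apply: commrD; last exact: in_alg_comm.
by apply: commrB; [exact: du_ud_comm | rewrite /GRing.comm -scalerAl -scalerAr].
Qed.

Definition evdu_spec :=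
  biv_eval R (in_alg_comm yelt) (in_alg_comm (u * d)) ud_yelt_comm.
Definition evdu := sval evdu_spec.

Lemma evduC c : evdu (kap c) = c%:A.
Proof. exact: (svalP evdu_spec).1. Qed.
Lemma evduy : evdu y = yelt.
Proof. exact: (svalP evdu_spec).2.1. Qed.
Lemma evduX : evdu x = u * d.
Proof. exact: (svalP evdu_spec).2.2. Qed.

Lemma evdu_sigmaX : evdu (sigma x) = d * u.
Proof.
by rewrite sigmaX rmorphB rmorphD rmorphM !evduC evduy yeltE evduX mulr_algl
  addrAC
  addrK subrK.
Qed.

Let cancel_s (a b c g e : A) : a + b - c + g - b + e = a - c + (g + e).
Proof. by rewrite addrA (addrAC a b) (addrAC _ b g) addrK. Qed.

Lemma d_yelt : d * yelt = r *: (yelt * d).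
Proof.
rewrite yeltE !(mulrDl, mulrDr, mulrN, mulNr) -!scalerAl -!scalerAr mulr1 mul1r.
rewrite !mulrA du_rel1 scalerDl !(scalerDr, scalerN) !scalerA -gamma_c0.
by rewrite scalerDl cancel_s.
Qed.

Lemma yelt_u : yelt * u = r *: (u * yelt).
Proof.
rewrite yeltE !(mulrDl, mulrDr, mulrN, mulNr) -!scalerAl -!scalerAr mulr1 mul1r.
rewrite !mulrA du_rel2 scalerDl !(scalerDr, scalerN) !scalerA -gamma_c0.
by rewrite scalerDl cancel_s.
Qed.

Lemma d_evdu p : d * evdu p = evdu (sigma p) * d.
Proof.
elim/biv_ind: p => [c|||p q Hp Hq|p q Hp Hq].
- by rewrite sigmaC evduC mulr_algl mulr_algr.
- by rewrite sigmay rmorphM evduC evduy d_yelt mulr_algl scalerAl.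
- by rewrite evdu_sigmaX evduX mulrA.
- by rewrite !rmorphD mulrDl mulrDr Hp Hq.
- by rewrite !rmorphM mulrA Hp -[_ * d * _]mulrA Hq mulrA.
Qed.

Lemma u_evdu p : u * evdu p = evdu (sigma' p) * u.
Proof.
(* Once p is written as a value of [sigma], the case of [x] is just u(du) = (ud)u. *)
rewrite -{1}(sigma'K p); move: (sigma' p) => {}p.
elim/biv_ind: p => [c|||p q Hp Hq|p q Hp Hq].
- by rewrite sigmaC evduC mulr_algl mulr_algr.
- by rewrite sigmay rmorphM evduC evduy mulr_algl -scalerAr yelt_u.
- by rewrite evdu_sigmaX evduX mulrA.
- by rewrite !rmorphD mulrDl mulrDr Hp Hq.
- by rewrite !rmorphM mulrA Hp -[_ * u * _]mulrA Hq mulrA.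
Qed.

Lemma x_neq0 : x != 0.
Proof.
apply/eqP => x0.
have [f [fC [fy fx]]] := biv_eval R (kappa := idfun : {rmorphism K -> K})
  (fun c => mulrC 0 c) (fun c => mulrC 1 c) (mulrC _ _).
by move/eqP: fx; rewrite x0 rmorph0 eq_sym oner_eq0.
Qed.

Lemma y_neq0 : y != 0.
Proof.
apply/eqP => y0.
have [f [fC [fy fx]]] := biv_eval R (kappa := idfun : {rmorphism K -> K})
  (fun c => mulrC 1 c) (fun c => mulrC 0 c) (mulrC _ _).
by move/eqP: fy; rewrite y0 rmorph0 eq_sym oner_eq0.
Qed.

Lemma sigma_eq0 p : (sigma p == 0) = (p == 0).
Proof. by rewrite -(inj_eq (can_inj sigmaK)) rmorph0. Qed.

Lemma sigma'_eq0 p : (sigma' p == 0) = (p == 0).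
Proof. by rewrite -(inj_eq (can_inj sigma'K)) rmorph0. Qed.

Definition dupow (n : int) : A :=
  match n with Posz k => d ^+ k | Negz k => u ^+ k.+1 end.

Definition sigma_ (n : int) : R -> R :=
  match n with Posz k => iter k sigma | Negz k => iter k.+1 sigma' end.

Lemma d_dupow n : exists2 c, c != 0 & d * dupow n = evdu c * dupow (n + 1).
Proof.
case: n => [k|k].
  exists 1; rewrite ?oner_neq0 // rmorph1 mul1r addrC -intS /=.
  by rewrite exprS.
exists (sigma x); first by rewrite sigma_eq0 x_neq0.
rewrite evdu_sigmaX /= exprS mulrA; congr (_ * _).
case: k => [//|k]; have -> // : Negz k.+1 + 1 = Negz k by lia.
Qed.

Lemma u_dupow n : exists2 c, c != 0 & u * dupow n = evdu c * dupow (n - 1).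
Proof.
case: n => [[|k]|k].
- by exists 1; rewrite ?oner_neq0 // rmorph1 mul1r /= mulr1 expr1.
- exists x; first exact: x_neq0.
  have -> : k.+1%:Z - 1 = k by lia.
  by rewrite evduX /= exprS mulrA.
exists 1; rewrite ?oner_neq0 // rmorph1 mul1r.
by have -> : Negz k - 1 = Negz k.+1 by lia.
Qed.

Lemma dupow_evdu n p : dupow n * evdu p = evdu (sigma_ n p) * dupow n.
Proof.
have iterM (a : A) (f : R -> R) : (forall p, a * evdu p = evdu (f p) * a) ->
    forall k p, a ^+ k * evdu p = evdu (iter k f p) * a ^+ k.
  move=> af; elim=> [|k IHk] q; first by rewrite expr0 mul1r mulr1.
  by rewrite exprS -mulrA IHk mulrA af -mulrA.
by case: n => k; apply: iterM; [exact: d_evdu | exact: u_evdu].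
Qed.

Lemma sigma_y n : sigma_ n y = kap (r ^ n) * y.
Proof.
have iterE (f : {rmorphism R -> R}) a : (forall c, f (kap c) = kap c) ->
    f y = kap a * y -> forall k, iter k f y = kap (a ^+ k) * y.
  move=> fC fy; elim=> [|k IHk] /=; first by rewrite rmorph1 mul1r.
  by rewrite IHk rmorphM fC fy mulrA -rmorphM -exprSr.
case: n => k; first by apply: iterE; [exact: sigmaC | exact: sigmay].
rewrite NegzE -exprnN -exprVn.
by apply: iterE; [exact: sigma'C | exact: sigma'y].
Qed.

Lemma sigma__eq0 n p : (sigma_ n p == 0) = (p == 0).
Proof.
have iterE (f : R -> R) : (forall q, (f q == 0) = (q == 0)) ->
    forall k, (iter k f p == 0) = (p == 0).
  by move=> f0; elim=> //= k IHk; rewrite f0.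
by case: n => k; apply: iterE; [exact: sigma_eq0 | exact: sigma'_eq0].
Qed.

(** Each du or ud that collapses contributes [sigma x] or [x]; as [R] is a domain and [sigma],
    [sigma'] are injective, the accumulated coefficient stays nonzero. *)
Lemma dupowD n m : exists2 c, c != 0 & dupow n * dupow m = evdu c * dupow (n +
  m).
Proof.
have powE (a : A) (f : {rmorphism R -> R}) e :
    (forall p, (f p == 0) = (p == 0)) ->
    (forall p, a * evdu p = evdu (f p) * a) ->
    (forall i, exists2 c, c != 0 & a * dupow i = evdu c * dupow (i + e)) ->
    forall k, exists2 c, c != 0 & a ^+ k * dupow m = evdu c * dupow (m + k%:Z *
      e).
  move=> f_eq0 af av; elim=> [|k [c c_neq0 IHk]].
    by exists 1; rewrite ?oner_neq0 // rmorph1 !mul1r mul0r addr0.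
  have [c' c'_neq0 E] := av (m + k%:Z * e).
  exists (f c * c'); first by rewrite mulf_neq0 ?f_eq0.
  rewrite exprS -mulrA IHk mulrA af -mulrA E mulrA -rmorphM.
  by rewrite intS mulrDl mul1r -addrA [e + _]addrC.
case: n => k.
  have [] := powE d sigma 1 sigma_eq0 d_evdu d_dupow k.
  by rewrite mulr1 addrC => c c_neq0 E; exists c.
have [] := powE u sigma' (-1) sigma'_eq0 u_evdu u_dupow k.+1.
by rewrite mulrN1 addrC -NegzE => c c_neq0 E; exists c.
Qed.

Lemma op_evdu (f : {lrmorphism A -> L}) p q : f d = op_d -> f u = op_u ->
  f (evdu p) q = p * q.
Proof.
move=> fd fu; elim/biv_ind: p q => [c|||p p' Hp Hq|p p' Hp Hq] q.
- by rewrite evduC linearZ rmorph1.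
- rewrite evduy yeltE rmorphD rmorphB /= !linearZ /= rmorph1 !rmorphM /= fd fu.
  rewrite /= rmorphM sigma'K sigmaK sigmaX.
  by ring.
- by rewrite evduX rmorphM /= fd fu /= sigmaK.
- by rewrite !rmorphD /= Hp Hq mulrDl.
- by rewrite !rmorphM /= Hp Hq mulrA.
Qed.

(** In the representation by [op_d] and [op_u], this element sends 1 to p times a nonzero
    polynomial: 1 for a power of d, a product of images of [x] for a power of u. *)
Lemma evdu_dupow_eq0 p n : evdu p * dupow n = 0 -> p = 0.
Proof.
move=> pv0.
have [f [fd fu]] := du_univ duA op_relations.
have /eqP : f (evdu p * dupow n) 1 = 0 by rewrite pv0 rmorph0.
rewrite rmorphM /= op_evdu // mulf_eq0 => /orP[/eqP//|/eqP].
suff : f (dupow n) 1 != 0 by move/eqP.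
case: n {pv0} => k; rewrite rmorphXn /= ?fd ?fu.
  by elim: k => [|k IHk]; rewrite ?oner_neq0 // exprS linopM /=
    sigma_eq0.
elim: k.+1 => [|{}k IHk]; rewrite ?oner_neq0 // exprS linopM /=.
by rewrite mulf_neq0 ?x_neq0 // sigma'_eq0.
Qed.

(** * The grading *)

Definition gr n a := exists p, a = evdu p * dupow n.

Lemma gr_dupow n : gr n (dupow n).
Proof. by exists 1; rewrite rmorph1 mul1r. Qed.

Lemma gr0 n : gr n 0.
Proof. by exists 0; rewrite rmorph0 mul0r. Qed.

Lemma grD n a b : gr n a -> gr n b -> gr n (a + b).
Proof. by move=> [p ->] [q ->]; exists (p + q); rewrite rmorphD mulrDl. Qed.

Lemma grZ n c a : gr n a -> gr n (c *: a).
Proof.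
by move=> [p ->]; exists (kap c * p); rewrite rmorphM evduC mulr_algl scalerAl.
Qed.

Lemma grN n a : gr n a -> gr n (- a).
Proof. by rewrite -scaleN1r; apply: grZ. Qed.

Lemma grB n a b : gr n a -> gr n b -> gr n (a - b).
Proof. by move=> ga gb; apply: grD => //; apply: grN. Qed.

Lemma evdu_dupow_mul p n q m : exists2 c, c != 0 &
  evdu p * dupow n * (evdu q * dupow m) = evdu (p * sigma_ n q * c) * dupow (n
    + m).
Proof.
have [c c_neq0 E] := dupowD n m; exists c => //.
rewrite mulrA -[_ * dupow n * _]mulrA dupow_evdu mulrA -rmorphM -[_ * dupow n *
  dupow m]mulrA E mulrA.
by rewrite -rmorphM.
Qed.

Lemma grM n m a b : gr n a -> gr m b -> gr (n + m) (a * b).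
Proof.
move=> [p ->] [q ->]; have [c _ ->] := evdu_dupow_mul p n q m.
by exists (p * sigma_ n q * c).
Qed.

Lemma gr_integral n m a b : gr n a -> gr m b -> a * b = 0 -> a = 0 \/ b = 0.
Proof.
move=> [p ->] [q ->]; have [c c_neq0 ->] := evdu_dupow_mul p n q m.
move/evdu_dupow_eq0/eqP; rewrite !mulf_eq0 (negPf c_neq0) orbF sigma__eq0.
by case/orP=> /eqP->; [left | right]; rewrite rmorph0 mul0r.
Qed.

Lemma gr_yelt n a : gr n a -> a * yelt = r ^ n *: (yelt * a).
Proof.
move=> [p ->]; rewrite -evduy -mulrA dupow_evdu sigma_y.
rewrite !mulrA -!rmorphM mulrA [p * _]mulrC -mulrA rmorphM evduC mulr_algl.
by rewrite scalerAl [p * y]mulrC.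
Qed.

Lemma dupow_neq0 n : dupow n != 0.
Proof.
apply/eqP => vn0; have := @evdu_dupow_eq0 1 n.
by rewrite vn0 mulr0 => /(_ erefl)/eqP; rewrite oner_eq0.
Qed.

Lemma evdu_inj : injective evdu.
Proof.
move=> p q pq; apply/eqP; rewrite -subr_eq0; apply/eqP.
by apply: (@evdu_dupow_eq0 _ 0); rewrite rmorphB pq subrr mul0r.
Qed.

(** Summands may repeat a degree or vanish; uniqueness of components is a separate matter, settled
    by [hsum_indep]. *)
Inductive hsum (P : int -> Prop) : A -> Prop :=
| hsum0 : hsum P 0
| hsumS n x a : P n -> gr n x -> hsum P a -> hsum P (x + a).

Lemma hsum_gr (P : int -> Prop) n a : P n -> gr n a -> hsum P a.
Proof. by move=> Pn ga; rewrite -[a]addr0; apply: hsumS Pn ga (hsum0 P). Qed.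

Lemma hsumD P a b : hsum P a -> hsum P b -> hsum P (a + b).
Proof.
move=> Pa Pb; elim: Pa => [|n h a' Pn gh _ IHa]; first by rewrite add0r.
by rewrite -addrA; apply: hsumS gh IHa.
Qed.

Lemma hsumZ P c a : hsum P a -> hsum P (c *: a).
Proof.
elim=> [|n h a' Pn gh _ IHa]; first by rewrite scaler0; left.
by rewrite scalerDr; apply: hsumS Pn (grZ c gh) IHa.
Qed.

Lemma hsumB P a b : hsum P a -> hsum P b -> hsum P (a - b).
Proof. by move=> Pa Pb; rewrite -scaleN1r; apply: hsumD => //; apply: hsumZ.
  Qed.

Lemma hsum_sub (P Q : int -> Prop) a :
  (forall n, P n -> Q n) -> hsum P a -> hsum Q a.
Proof.
move=> PQ; elim=> [|n h a' Pn gh _ IHa]; first by left.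
by apply: hsumS gh IHa; apply: PQ.
Qed.

Lemma hsumM (P Q S : int -> Prop) a b :
  (forall i j, P i -> Q j -> S (i + j)) ->
  hsum P a -> hsum Q b -> hsum S (a * b).
Proof.
move=> PQ; elim=> [|n h a' Pn gh _ IHa] Qb; first by rewrite mul0r; left.
rewrite mulrDl; apply: hsumD (IHa Qb).
elim: Qb => [|m k b' Qm gk _ IHb]; first by rewrite mulr0; left.
by rewrite mulrDr; apply: hsumS (grM gh gk) IHb; apply: PQ.
Qed.

(** Used with the identity to decompose the whole algebra, and with an automorphism to bound its
    image in [aut_not_one_sided]. *)
Lemma hsum_alg (P : int -> Prop) (f : {lrmorphism A -> A}) :
  P 0 -> (forall i j, P i -> P j -> P (i + j)) ->
  hsum P (f d) -> hsum P (f u) -> forall a, hsum P (f a).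
Proof.
move=> P0 PD Pd Pu; apply: (du_ind duA) => // [c|a b|a b] *.
- rewrite linearZ rmorph1; apply: hsumZ; apply: hsum_gr P0 _.
  exact: (gr_dupow 0).
- by rewrite rmorphD; apply: hsumD.
- by rewrite rmorphM; apply: hsumM PD _ _.
Qed.

Lemma hsum_all a : hsum (fun _ => True) a.
Proof.
apply: (hsum_alg (f := idfun)) => //=.
  exact: hsum_gr (gr_dupow 1).
exact: hsum_gr (gr_dupow (-1)).
Qed.

Lemma yelt_neq0 : yelt != 0.
Proof.
rewrite -evduy; apply/eqP => y0.
have := @evdu_dupow_eq0 y 0; rewrite y0 mul0r => /(_ erefl) /eqP.
exact/negP/y_neq0.
Qed.

Lemma gr0_yelt : gr 0 yelt.
Proof. by exists y; rewrite evduy mulr1. Qed.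

Lemma gr_yelt_mul n a : gr n a -> gr n (yelt * a).
Proof.
by move=> ga; rewrite -[n]add0r; apply: grM ga; apply: gr0_yelt.
Qed.

Lemma exprz_inj n m : r ^ n = r ^ m -> n = m.
Proof.
move=> E; apply/eqP; rewrite -subr_eq0; apply/eqP.
have : r ^ (n - m) = 1 by rewrite expfzDr // -invr_expz E mulfV // expfz_neq0.
case: (n - m) => [[//|k]|k] /eqP.
  by rewrite (negPf (expr_r_neq1 _)).
by rewrite NegzE -exprnN invr_eq1 (negPf (expr_r_neq1 _)).
Qed.

(* The components of a sum are separated by the twisted commutators           *)
(* [a |-> a y - r^m y a], which kill degree [m] only.                         *)
Lemma hsum_indep n h a : gr n h -> hsum (fun i => i <> n) a -> h + a = 0 ->
  h = 0.
Proof.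
move=> gh hs.
suff [Phi [PhiD Phia Phi0 _]] : exists Phi : A -> A,
  [/\ {morph Phi : b c / b + c}, Phi a = 0,
      (forall k, gr n k -> Phi k = 0 -> k = 0) &
      (forall m k, gr m k -> gr m (Phi k))].
  move=> ha0; apply: Phi0 => //; have /(congr1 Phi) := ha0.
  rewrite PhiD Phia addr0 => ->.
  by apply: (@addrI _ (Phi 0)); rewrite -PhiD !addr0.
elim: hs => [|m k b m_neq_n gk _ [Phi [PhiD Phib Phi0 Phig]]].
  by exists idfun; split.
exists (fun c => Phi c * yelt - r ^ m *: (yelt * Phi c)); split.
- move=> c e; rewrite PhiD mulrDl [yelt * _]mulrDr scalerDr opprD.
  by rewrite addrACA.
- rewrite PhiD Phib addr0 (gr_yelt (Phig _ _ gk)) subrr //.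
- move=> c gc; have gPc := Phig _ _ gc; rewrite (gr_yelt gPc) -scalerBl => /eqP.
  rewrite scaler_eq0 subr_eq0 => /orP[/eqP/exprz_inj E|/eqP E].
    by case: m_neq_n.
  apply: Phi0 => //; have [E0|//] := gr_integral gr0_yelt gPc E.
  by have := yelt_neq0; rewrite E0 eqxx.
- move=> i c gc; have gPc := Phig _ _ gc; apply: grB.
    by rewrite (gr_yelt gPc); apply/grZ/gr_yelt_mul.
  by apply/grZ/gr_yelt_mul.
Qed.

Lemma hsum_split k P a : hsum P a ->
  exists a1 a2, [/\ a = a1 + a2, gr k a1 & hsum (fun i => P i /\ i <> k) a2].
Proof.
elim=> [|n h b Pn gh _ [a1 [a2 [-> ga1 sa2]]]].
  by exists 0, 0; split; [rewrite addr0 | exact: gr0 | left].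
case: (eqVneq n k) => [nk|/eqP nk].
  exists (h + a1), a2; split=> //; first by rewrite addrA.
  by apply: grD => //; rewrite -nk.
by exists a1, (h + a2); split; [rewrite addrCA | | apply: hsumS gh sa2].
Qed.

(** * Components of extreme degree *)

Definition lt_deg (e : bool) (i j : int) : bool := if e then i < j else j < i.

(** A normal form with nonzero components in strict order of degree, all before the bound, so that
    the outermost summand is the extreme component. *)
Inductive sorted_sum e : int -> A -> Prop :=
| sorted_sum0 m : sorted_sum e m 0
| sorted_sumS m n x a : lt_deg e n m -> gr n x -> x != 0 ->
    sorted_sum e n a -> sorted_sum e m (x + a).

Lemma lt_deg_total e i j : [\/ lt_deg e i j, i = j | lt_deg e j i].
Proof.
rewrite /lt_deg; case: e; case: (Order.TotalTheory.ltgtP i j); by [constructor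
  1 | constructor 2
  | constructor 3].
Qed.

Lemma sorted_sum_weak e m n a : lt_deg e m n ->
  sorted_sum e m a -> sorted_sum e n a.
Proof.
move=> mn sa; case: m a / sa mn => [i|i j x a ji gx x0 sa] mn; first by left.
apply: sorted_sumS gx x0 sa; move: ji mn; rewrite /lt_deg; case: (e); lia.
Qed.

Lemma sorted_sum_add e m n x a : lt_deg e n m -> gr n x ->
  sorted_sum e m a -> sorted_sum e m (x + a).
Proof.
move=> nm gx sa; elim: m a / sa n x nm gx => [m|m k z a km gz z0 sa IHa] n x.
  move=> nm gx; case: (eqVneq x 0) => [->|x0]; first by rewrite addr0; left.
  by apply: sorted_sumS nm gx x0 _; left.
move=> nm gx; case: (lt_deg_total e n k) => [nk|nk|kn].
- by rewrite addrCA; apply: sorted_sumS km gz z0 _; apply: IHa nk gx.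
- rewrite addrA; case: (eqVneq (x + z) 0) => [->|xz0].
    by rewrite add0r; apply: sorted_sum_weak sa.
  by apply: sorted_sumS km _ xz0 sa; rewrite nk in gx; apply: grD.
- case: (eqVneq x 0) => [->|x0]; first by rewrite add0r; apply: sorted_sumS sa.
  by apply: sorted_sumS nm gx x0 _; apply: sorted_sumS sa.
Qed.

Lemma sorted_sum_all e a : exists m, sorted_sum e m a.
Proof.
elim: (hsum_all a) => [|n x b _ gx _ [m sb]]; first by exists 0; left.
have [k nk mk] : exists2 k, lt_deg e n k & lt_deg e m k.
  rewrite /lt_deg; case: e {sb}; [exists (Num.max n m + 1) |
    exists (Num.min n m - 1)]; lia.
by exists k; apply: sorted_sum_add nk gx _; apply: sorted_sum_weak sb.
Qed.

Lemma sorted_sum_hsum e m a :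
  sorted_sum e m a -> hsum (fun i => lt_deg e i m) a.
Proof.
elim=> {m a} [m|m n x a nm gx _ _ IHa]; first by left.
apply: (hsumS nm gx); apply: hsum_sub IHa => i.
by move: nm; rewrite /lt_deg; case: (e); lia.
Qed.

(** The top component when [e] is true, the bottom one when it is false; the flag lets one argument
    treat both ends. *)
Definition leading e n h a :=
  [/\ gr n h, h != 0 & hsum (fun i => lt_deg e i n) (a - h)].

Lemma leading_exists e a : a != 0 -> exists n h, leading e n h a.
Proof.
have [m sa] := sorted_sum_all e a; case: m a / sa => [m|m n x a nm gx x0 sa].
  by rewrite eqxx.
move=> _; exists n, x; split=> //.
by rewrite addrAC subrr add0r; apply: sorted_sum_hsum sa.
Qed.

Lemma lt_deg_neq e i n : lt_deg e i n -> i <> n.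
Proof. by rewrite /lt_deg; case: (e); lia. Qed.

(** All components of a lie at or before degree n, so independence would force [k], of degree m, to
    vanish. *)
Lemma leading_lt_absurd e n h m k a : leading e n h a -> leading e m k a ->
  lt_deg e n m -> False.
Proof.
move=> [gh _ sh] [gk k0 sk] nm; move/eqP: k0; apply.
apply: (hsum_indep gk (a := (a - k) - (a - h) - h)); last first.
  by rewrite -addrA -opprD subrK addrA [k + _]addrC subrK subrr.
apply: hsumB; first apply: hsumB.
- by apply: hsum_sub sk => i; apply: lt_deg_neq.
- apply: hsum_sub sh => i; move: nm; rewrite /lt_deg; case: (e); lia.
- by apply: hsum_gr gh; apply: lt_deg_neq nm.
Qed.

Lemma leading_uniq e n h m k a : leading e n h a -> leading e m k a -> n = m /\
  h = k.
Proof.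
move=> th tk; case: (lt_deg_total e n m) => [nm|nm|mn].
- by case: (leading_lt_absurd th tk nm).
- split=> //; subst m; case: th tk => [gh _ sh] [gk _ sk].
  apply/eqP; rewrite -subr_eq0; apply/eqP.
  apply: (hsum_indep (grB gh gk) (a := (a - h) - (a - k))).
    by apply: hsumB; [apply: hsum_sub sh | apply: hsum_sub sk] => i;
      apply: lt_deg_neq.
  by rewrite opprB [a - h + _]addrC !addrA !subrK subrr.
- by case: (leading_lt_absurd tk th mn).
Qed.

Lemma leadingM e n h m k a b : leading e n h a -> leading e m k b ->
  leading e (n + m) (h * k) (a * b).
Proof.
move=> [gh h0 sh] [gk k0 sk]; split; first exact: grM.
  by apply/eqP => /(gr_integral gh gk) [] /eqP; apply/negP.
have -> : a * b - h * k = (a - h) * k + (a - h) * (b - k) + h * (b - k).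
  by rewrite -mulrDr [k + _]addrC subrK mulrBl mulrBr addrA subrK.
have lt2 i j n' m' : lt_deg e i n' -> lt_deg e j m' -> lt_deg e (i + j) (n' +
  m').
  by rewrite /lt_deg; case: (e); lia.
apply: hsumD; first apply: hsumD.
- apply: hsumM sh (hsum_gr (P := eq m) erefl gk) => i j + <-.
  by rewrite /lt_deg; case: (e); lia.
- by apply: hsumM sh sk => i j; apply: lt2.
- apply: hsumM (hsum_gr (P := eq n) erefl gh) sk => i j <-.
  by rewrite /lt_deg; case: (e); lia.
Qed.

Lemma leading_gr e n h : gr n h -> h != 0 -> leading e n h h.
Proof. by move=> gh h0; split=> //; rewrite subrr; left. Qed.

Lemma A_integral (a b : A) : a * b = 0 -> a = 0 \/ b = 0.
Proof.
move=> ab; case: (eqVneq a 0) => [|a0]; first by left.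
case: (eqVneq b 0) => [|b0]; first by right.
have [n [h th]] := leading_exists true a0; have [m [k tk]] := leading_exists
  true b0.
have [ghk hk0 shk] := leadingM th tk; rewrite ab sub0r in shk.
move/eqP: hk0; case; apply: (hsum_indep ghk (a := - (h * k))).
  by apply: hsum_sub shk => i; apply: lt_deg_neq.
exact: subrr.
Qed.

Lemma leading_mem (P : int -> Prop) e n h a : hsum P a -> leading e n h a -> P
  n.
Proof.
move=> sa [gh h0 sh]; apply: contrapT => nPn; move/eqP: h0; apply.
apply: (hsum_indep gh (a := (a - h) - a)).
  apply: hsumB; first by apply: hsum_sub sh => i; apply: lt_deg_neq.
  by apply: hsum_sub sa => i Pi ni; apply: nPn; rewrite -ni.
by rewrite addrAC subrr sub0r subrr.
Qed.

(** A nonzero remainder a - h would have its top degree below n because of [h], and at least n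
    because of [k]. *)
Lemma gr_leadings n h k a : leading true n h a -> leading false n k a -> gr n a.
Proof.
move=> [gh h0 sh] [gk k0 sk].
suff -> : a = h by [].
apply/eqP; rewrite -subr_eq0; apply/negPn/negP => ah0.
have [m [l tl]] := leading_exists true ah0.
have mn := leading_mem sh tl.
suff : n <= m by move: mn; rewrite /lt_deg; lia.
apply: (leading_mem (P := fun i => is_true (n <= i))) tl.
have -> : a - h = (a - k) + (k - h) by rewrite addrA subrK.
apply: hsumD; first by apply: hsum_sub sk => i; rewrite /lt_deg; lia.
by apply: hsum_gr (grB gk gh); lia.
Qed.

(** * Normal elements and homogeneity of images *)

Lemma gr_left (w b b' : A) m : w != 0 -> b != 0 -> gr m b -> w * b = b' * w ->
  gr m b'.
Proof.
move=> w0 b0 gb E.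
have b'0 : b' != 0.
  apply/eqP => b'0; move: E; rewrite b'0 mul0r => /A_integral[] /eqP;
    exact/negP.
(* Extreme degrees add under products, so at either end the degree of w cancels and b' has the
   extreme degree m. *)
have tops e : exists h, leading e m h b'.
  have [n [h tw]] := leading_exists e w0; have [j [k tb']] := leading_exists e
    b'0.
  exists k; have := leadingM tw (leading_gr e gb b0); rewrite E => t.
  have [nm _] := leading_uniq t (leadingM tb' tw).
  by have -> : m = j by lia.
by have [[h t] [k t']] := (tops true, tops false); apply: gr_leadings t t'.
Qed.

Lemma gr_right (w b b' : A) m : w != 0 -> b != 0 -> gr m b -> b * w = w * b' ->
  gr m b'.
Proof.
move=> w0 b0 gb E.
have b'0 : b' != 0.
  apply/eqP => b'0; move: E; rewrite b'0 mulr0 => /A_integral[] /eqP;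
    exact/negP.
have tops e : exists h, leading e m h b'.
  have [n [h tw]] := leading_exists e w0; have [j [k tb']] := leading_exists e
    b'0.
  exists k; have := leadingM (leading_gr e gb b0) tw; rewrite E => t.
  have [nm _] := leading_uniq t (leadingM tw tb').
  by have -> : m = j by lia.
by have [[h t] [k t']] := (tops true, tops false); apply: gr_leadings t t'.
Qed.

Lemma yelt_normal_left a : exists a', yelt * a = a' * yelt.
Proof.
elim: (hsum_all a) => [|n h b _ gh _ [b' E]].
  by exists 0; rewrite mulr0 mul0r.
exists (r ^ (- n) *: h + b'); rewrite mulrDr E mulrDl -scalerAl (gr_yelt gh).
by rewrite scalerA -expfzDr // addNr expr0z scale1r.
Qed.

Lemma yelt_normal_right a : exists a', a * yelt = yelt * a'.
Proof.
elim: (hsum_all a) => [|n h b _ gh _ [b' E]].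
  by exists 0; rewrite mulr0 mul0r.
by exists (r ^ n *: h + b'); rewrite mulrDr -E mulrDl -scalerAr (gr_yelt gh).
Qed.

(** Cancelling v = [dupow m] on the right of w v = p v w = p w q v gives w = p w q. If t [dupow n]
    is the top component of w, then t = p t sigma^n(q), so p is a unit of [R]. *)
Lemma twist_unit (w : A) m p q : w != 0 ->
  w * dupow m = evdu p * dupow m * w -> dupow m * w = w * (evdu q * dupow m) ->
  exists c, p = kap c.
Proof.
move=> w0 E1 E2.
have wE : w = evdu p * w * evdu q.
  apply/eqP; rewrite -subr_eq0; apply/eqP.
  have : (w - evdu p * w * evdu q) * dupow m = 0.
    by rewrite mulrBl E1 -mulrA E2 !mulrA subrr.
  by case/A_integral=> // /eqP /(negP (dupow_neq0 m)).
have [n [h tw]] := leading_exists true w0.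
have g0 z : gr 0 (evdu z) by exists z; rewrite mulr1.
have i0 z : z != 0 -> evdu z != 0.
  by move=> z0; apply: contra_neq z0 => z0; apply: evdu_inj; rewrite z0 rmorph0.
have p0 : p != 0.
  by apply/eqP => p0; move: wE w0; rewrite p0 rmorph0 !mul0r => ->; rewrite
    eqxx.
have q0 : q != 0.
  by apply/eqP => q0; move: wE w0; rewrite q0 rmorph0 mulr0 => ->; rewrite eqxx.
have := leadingM (leadingM (leading_gr true (g0 p) (i0 _ p0)) tw) (leading_gr
  true (g0 q) (i0 _ q0)).
rewrite -wE => /(leading_uniq tw) [_]; have [[t ->] t0 _] := tw.
rewrite -mulrA -[_ * dupow n * _]mulrA dupow_evdu !mulrA -!rmorphM => /eqP.
rewrite -subr_eq0 -mulrBl -rmorphB => /eqP/evdu_dupow_eq0/eqP.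
rewrite subr_eq0 => /eqP tE; apply: (biv_unit (q := sigma_ n q)).
have t_neq0 : t != 0.
  by apply: contra_neq t0 => ->; rewrite rmorph0 mul0r.
by apply: (mulfI t_neq0); rewrite mulr1 mulrCA mulrA -tE.
Qed.

(** The top and bottom components satisfy the same equation, so c is r to the power of either
    degree, and the two degrees agree. *)
Lemma eigen_gr c a : a * yelt = c *: (yelt * a) -> exists j, gr j a.
Proof.
move=> E; case: (eqVneq a 0) => [->|a0]; first by exists 0; apply: gr0.
have eig e n h : leading e n h a -> c = r ^ n.
  move=> [gh h0 sh].
  have cE : (r ^ n - c) *: (yelt * h) = 0.
    apply: (hsum_indep (grZ _ (gr_yelt_mul gh))
      (a := (a - h) * yelt - c *: (yelt * (a - h)))).
      apply: hsumB; [|apply: hsumZ].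
        apply: hsumM sh (hsum_gr (P := eq 0) erefl gr0_yelt) => i j + <-.
        by rewrite addr0; apply: lt_deg_neq.
      apply: hsumM (hsum_gr (P := eq 0) erefl gr0_yelt) sh => i j <-.
      by rewrite add0r; apply: lt_deg_neq.
    rewrite mulrBl [yelt * (a - h)]mulrBr scalerBr E (gr_yelt gh) scalerBl.
    by rewrite opprB [_ - _ + (_ - _)]addrC -/(_ - _) !addrA !subrK subrr.
  move/eqP: cE; rewrite scaler_eq0 subr_eq0 => /orP[/eqP//|/eqP].
  by case/(gr_integral gr0_yelt gh)=> /eqP;
    [move/(negP yelt_neq0) | move/(negP h0)].
have [n [h th]] := leading_exists true a0; have [m [k tk]] := leading_exists
  false a0.
exists n; have nm : n = m by apply: exprz_inj; rewrite -(eig _ _ _ th) (eig _ _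
  _ tk).
by subst m; apply: gr_leadings th tk.
Qed.

(** Being normal is preserved by g, so [twist_unit] applies to w = g(yelt); carrying w v = c v w
    back by f gives an equation for [eigen_gr]. *)
Lemma aut_gr (f g : {lrmorphism A -> A}) : cancel f g -> cancel g f ->
  forall m, exists j, gr j (f (dupow m)).
Proof.
move=> fK gK m.
have w0 : g yelt != 0.
  by apply: contra_neq yelt_neq0 => w0; rewrite -[yelt]gK w0 rmorph0.
have [a1 E1] := yelt_normal_left (f (dupow m)).
have [a2 E2] := yelt_normal_right (f (dupow m)).
have {}E1 : g yelt * dupow m = g a1 * g yelt by rewrite -[dupow m in LHS]fK
  -!rmorphM E1.
have {}E2 : dupow m * g yelt = g yelt * g a2 by rewrite -[dupow m in LHS]fK
  -!rmorphM E2.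
have [p pE] := gr_left w0 (dupow_neq0 m) (gr_dupow m) E1.
have [q qE] := gr_right w0 (dupow_neq0 m) (gr_dupow m) E2.
rewrite {}pE in E1; rewrite {}qE in E2.
have [c pc] := twist_unit w0 E1 E2; rewrite pc evduC mulr_algl -scalerAl in E1.
have {}E1 : yelt * f (dupow m) = c *: (f (dupow m) * yelt).
  by rewrite -[yelt]gK -!rmorphM E1 /= linearZ.
have c0' : c != 0.
  apply/eqP => c0'; move: E1; rewrite c0' scale0r => /A_integral[/eqP|/eqP].
    exact/negP/yelt_neq0.
  move/eqP/(congr1 g); rewrite fK rmorph0 => /eqP; exact/negP/dupow_neq0.
by apply: (@eigen_gr c^-1); rewrite E1 scalerA mulVf // scale1r.
Qed.

(** * Automorphisms and generators *)

(** Otherwise the image of f, which is the whole algebra, would lie on one side of degree 0. *)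
Lemma aut_not_one_sided (f g : {lrmorphism A -> A}) e j k : cancel g f ->
  gr j (f d) -> gr k (f u) -> lt_deg e j 0 || lt_deg e k 0.
Proof.
move=> gK gd gu; apply/negPn; rewrite negb_or; apply/negP => /andP[nj nk].
have [m m0] : exists m, lt_deg e m 0.
  by exists (if e then -1 else 1); rewrite /lt_deg; case: (e).
pose P i : Prop := ~~ lt_deg e i 0.
have sP : hsum P (dupow m).
  rewrite -[dupow m]gK; apply: hsum_alg.
  - by rewrite /P /lt_deg; case: (e).
  - by move=> i i'; rewrite /P /lt_deg; case: (e); lia.
  - exact: hsum_gr nj gd.
  - exact: hsum_gr nk gu.
by have /negP := leading_mem sP (leading_gr e (gr_dupow m) (dupow_neq0 m)).
Qed.

(** * Factorizations of the generators *)

Lemma augmentation : exists chi : {rmorphism A -> K}, chi d = 0 /\ chi u = 0.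
Proof.
have [|chi [chid chiu]] := du_univ duA (C := K^o) (x := 0) (y := 0).
  by split; rewrite expr2 !(mul0r, mulr0, scaler0, addr0).
by exists chi.
Qed.

(** Only the component of a in degree -m matters. The augmentation kills [dupow m] unless m = 0, and
    in degree 0 the equation says that two polynomials have product 1. *)
Lemma left_unit_scalar (a b : A) m : a * b = 1 -> gr m b -> m = 0 /\ exists c,
  b = c%:A.
Proof.
move=> ab1 gb; have [a1 [a2 [aE ga1 sa2]]] := hsum_split (- m) (hsum_all a).
have {aE ab1} a1b : a1 * b = 1.
  apply/eqP; rewrite -subr_eq0; apply/eqP.
  apply: (@hsum_indep 0 _ (a2 * b)).
  - by apply: grB (gr_dupow 0); rewrite -(addNr m); apply: grM.
  - apply: (hsumM _ sa2 (hsum_gr (P := eq m) erefl gb)) => i j [_ im] <-; lia.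
  - by rewrite addrAC -mulrDl -aE ab1 subrr.
have [[p pE] [q qE]] := (ga1, gb).
have m0 : m = 0.
  have [chi [chid chiu]] := augmentation.
  have : chi (dupow m) != 0.
    apply/eqP => chi0; have /eqP : chi 1 = 0.
      by rewrite -a1b qE !rmorphM /= chi0 !mulr0.
    by rewrite rmorph1 oner_eq0.
  by case: (m) => [[//|k]|k]; rewrite rmorphXn /= ?chid ?chiu expr0n eqxx.
split=> //; subst m; rewrite oppr0 /= mulr1 in pE; rewrite /= mulr1 in qE.
have [|c qc] := biv_unit (p := q) (q := p).
  by apply: evdu_inj; rewrite rmorph1 mulrC rmorphM -pE -qE.
by exists c; rewrite qE qc evduC.
Qed.

Lemma x_nonunit z : z * x <> 1.
Proof.
have [f [_ [_ fx]]] := biv_eval R (kappa := idfun : {rmorphism K -> K})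
  (fun c => mulrC 0 c) (fun c => mulrC 0 c) (mulrC _ _).
move/(congr1 f)/eqP; rewrite rmorphM fx mulr0 rmorph1 eq_sym.
by rewrite oner_eq0.
Qed.

Lemma gr_mulr n m (a b c : A) : gr n b -> gr (m + n) c -> a * b = c ->
  exists2 a1, gr m a1 & a1 * b = c.
Proof.
move=> gb gc abc; have [a1 [a2 [aE ga1 sa2]]] := hsum_split m (hsum_all a).
exists a1 => //; apply/eqP; rewrite -subr_eq0; apply/eqP.
apply: (@hsum_indep (m + n) _ (a2 * b)).
- by apply: grB gc; apply: grM.
- apply: (hsumM _ sa2 (hsum_gr (P := eq n) erefl gb)) => i j [_ im] <-; lia.
- by rewrite addrAC -mulrDl -aE abc subrr.
Qed.

(** By degrees a may be taken as z d^2; then z d^2 u = z sigma(sigma x) d equals d, which would make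
    [x] invertible. *)
Lemma u_ndvd_d (a : A) : a * u <> d.
Proof.
move=> au; have [_ [z ->] zE] := @gr_mulr (-1) 2 a u d (gr_dupow (-1))
  (gr_dupow 1) au.
apply: (@x_nonunit (sigma' (sigma' z))).
rewrite -[x]sigmaK -[sigma x]sigmaK -!rmorphM -[RHS](rmorph1 sigma').
rewrite -[1 in RHS](rmorph1 sigma'); congr (sigma' (sigma' _)).
apply/eqP; rewrite -subr_eq0; apply/eqP/(@evdu_dupow_eq0 _ 1).
rewrite /= rmorphB rmorph1 mulrBl mul1r rmorphM -mulrA -d_evdu evdu_sigmaX.
by rewrite -[X in _ - X]zE /= expr2 !mulrA subrr.
Qed.

Lemma d_ndvd_u (a : A) : a * d <> u.
Proof.
move=> ad; have [_ [z ->] zE] := @gr_mulr 1 (- 2) a d u (gr_dupow 1) (gr_dupow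
  (-1)) ad.
apply: (@x_nonunit (sigma z)).
rewrite -[x]sigma'K -!rmorphM -[RHS](rmorph1 sigma); congr (sigma _).
apply/eqP; rewrite -subr_eq0; apply/eqP/(@evdu_dupow_eq0 _ (-1)).
rewrite /= rmorphB rmorph1 mulrBl mul1r rmorphM -mulrA -u_evdu evduX.
by rewrite -[X in _ - X]zE /= expr2 !mulrA subrr.
Qed.

Lemma gr_factor n a : gr n a -> n != 0 ->
  if 0 < n then exists2 b, gr (n - 1) b & a = b * d
           else exists2 b, gr (n + 1) b & a = b * u.
Proof.
move=> [p ->]; case: n => [[//|k]|k] _ /=.
  exists (evdu p * dupow k); last by rewrite /= exprSr mulrA.
  by exists p; congr (_ * dupow _); lia.
exists (evdu p * u ^+ k); last by rewrite exprSr mulrA.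
exists p; congr (_ * _); case: k => [|k]; first by rewrite expr0.
by have -> : Negz k.+1 + 1 = Negz k by lia.
Qed.

Lemma A_mulIr (a b c : A) : c != 0 -> a * c = b * c -> a = b.
Proof.
move=> nz /eqP; rewrite -subr_eq0 -mulrBl => /eqP/A_integral[/eqP|/eqP].
  by rewrite subr_eq0 => /eqP.
by rewrite (negPf nz).
Qed.

(** Such a b ends in d or in u. Ending in u is excluded by [u_ndvd_d]; ending in d, its cofactor has
    a left inverse and is a scalar. *)
Lemma irreducible_d (a b : A) n : a * b = d -> gr n b -> n != 0 ->
  exists c, b = c *: d.
Proof.
move=> abd gb n0; have := gr_factor gb n0; case: ifP => _ [b' gb' bE].
  have ab' : a * b' = 1.
    by apply: (A_mulIr (dupow_neq0 1)); rewrite -mulrA -bE mul1r.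
  have [_ [c b'E]] := left_unit_scalar ab' gb'.
  by exists c; rewrite bE b'E mulr_algl.
by case: (@u_ndvd_d (a * b')); rewrite -mulrA -bE.
Qed.

Lemma irreducible_u (a b : A) n : a * b = u -> gr n b -> n != 0 ->
  exists c, b = c *: u.
Proof.
move=> abu gb n0; have := gr_factor gb n0; case: ifP => _ [b' gb' bE].
  by case: (@d_ndvd_u (a * b')); rewrite -mulrA -bE.
have ab' : a * b' = 1.
  by apply: (A_mulIr (dupow_neq0 (-1))); rewrite -mulrA -bE mul1r.
have [_ [c b'E]] := left_unit_scalar ab' gb'.
by exists c; rewrite bE b'E mulr_algl.
Qed.

Lemma d_neq0 : d != 0. Proof. exact: (dupow_neq0 1). Qed.
Lemma u_neq0 : u != 0. Proof. exact: (dupow_neq0 (-1)). Qed.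

Lemma d_u_indep a b : a *: d = b *: u -> a = 0.
Proof.
move=> E; apply/eqP/negPn/negP => a0.
have ad0 : a *: d != 0 by rewrite scaler_eq0 negb_or a0 d_neq0.
have t1 := leading_gr true (grZ a (gr_dupow 1)) ad0.
have t2 : leading true (-1) (b *: u) (a *: d).
  by rewrite E; apply: leading_gr; [exact: grZ (gr_dupow (-1)) | rewrite -E].
by have [] := leading_uniq t1 t2.
Qed.

Lemma aut_degree_neq0 (f g : {lrmorphism A -> A}) j k : cancel g f ->
  gr j (f d) -> gr k (f u) -> (j != 0) && (k != 0).
Proof.
move=> gK gd gu.
have := aut_not_one_sided true gK gd gu; have := aut_not_one_sided false gK gd
  gu.
rewrite /lt_deg; lia.
Qed.

(** As g(d) has nonzero degree, it ends in d or in u; applying f makes f(d) or f(u) a right factor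
    of d, hence a multiple of d. The same holds for u, and the mixed outcomes would make d and u
    proportional. *)
Lemma aut_generators (f g : {lrmorphism A -> A}) : cancel f g -> cancel g f ->
  exists a b, [/\ a != 0, b != 0 &
    (f d = a *: d /\ f u = b *: u) \/ (f d = b *: u /\ f u = a *: d)].
Proof.
move=> fK gK.
have [j gfd] := aut_gr fK gK 1; have [k gfu] := aut_gr fK gK (-1).
have [j' ggd] := aut_gr gK fK 1; have [k' ggu] := aut_gr gK fK (-1).
have /andP[j0 k0] := aut_degree_neq0 gK gfd gfu.
have /andP[j'0 k'0] := aut_degree_neq0 fK ggd ggu.
have f_neq0 a : a != 0 -> f a != 0.
  by move=> a0; rewrite -(rmorph0 f) (inj_eq (can_inj fK)).
have scal_neq0 (a c : A) (e : K) : a != 0 -> f a = e *: c -> e != 0.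
  by move=> /f_neq0 fa0 fa; apply: contra_neq fa0 => e0; rewrite fa e0 scale0r.
have dE : (exists a, f d = a *: d) \/ (exists a, f u = a *: d).
  have := gr_factor ggd j'0; case: ifP => _ [b _ gdE]; [left | right];
    apply: (irreducible_d (a := f b)); eauto;
    by rewrite -rmorphM -gdE /= expr1 gK.
have uE : (exists a, f u = a *: u) \/ (exists a, f d = a *: u).
  have := gr_factor ggu k'0; case: ifP => _ [b _ guE]; [right | left];
    apply: (irreducible_u (a := f b)); eauto;
    by rewrite -rmorphM -guE /= expr1 gK.
case: dE => [[a fd]|[a fu]]; case: uE => [[b fu']|[b fd']].
- exists a, b; split; [exact: scal_neq0 d_neq0 fd | exact: scal_neq0 u_neq0 fu'
    | by left].
- have := scal_neq0 _ _ _ d_neq0 fd; rewrite fd in fd'.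
  by rewrite (d_u_indep fd') eqxx.
- have := scal_neq0 _ _ _ u_neq0 fu; rewrite fu in fu'.
  by rewrite (d_u_indep fu') eqxx.
- exists a, b; split; [exact: scal_neq0 u_neq0 fu | exact: scal_neq0 d_neq0 fd'
    | by right].
Qed.

(** * Scalars allowed by the relations *)

Lemma diag_gamma (f : {lrmorphism A -> A}) a b : a != 0 ->
  f d = a *: d -> f u = b *: u -> gamma != 0 -> a * b = 1.
Proof.
move=> a0 fd fu gamma0; have /(congr1 f) := du_rel1.
rewrite rmorphD rmorphB /= !linearZ /= !rmorphM /= fd fu.
rewrite -!(scalerAl, scalerAr) !scalerA du_rel1 !scalerDr !scalerN !scalerA.
have -> : (r + s) * a * (a * b) = b * (a * a) * (r + s) by ring.
have -> : r * s * (a * (b * a)) = b * (a * a) * (r * s) by ring.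
(* The cubic terms agree on both sides, which leaves b a^2 gamma d = gamma a d. *)
move/addrI/eqP; rewrite -subr_eq0 -scalerBl scaler_eq0 (negPf d_neq0) orbF.
have -> : b * (a * a) * gamma - gamma * a = gamma * a * (a * b - 1) by ring.
by rewrite !mulf_eq0 (negPf gamma0) (negPf a0) subr_eq0 => /eqP.
Qed.

Lemma bivariate_linear_eq0 a b c : kap a * x + kap b * y + kap c = 0 ->
  [/\ a = 0, b = 0 & c = 0].
Proof.
move=> E.
have ev e1 e2 : a * e1 + b * e2 + c = 0.
  have [f [fC [fy fx]]] := biv_eval R (kappa := idfun : {rmorphism K -> K})
    (fun c => mulrC e2 c) (fun c => mulrC e1 c) (mulrC _ _).
  by have := congr1 f E; rewrite !rmorphD !rmorphM !fC fy fx rmorph0.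
have c_0 : c = 0 by rewrite -(ev 0 0) !mulr0 !add0r.
split=> //.
  by rewrite -(ev 1 0) c_0 mulr0 mulr1 !addr0.
by rewrite -(ev 0 1) c_0 mulr0 mulr1 add0r addr0.
Qed.

(** The image of the first relation is a polynomial times u. Cancelling u and applying [sigma]
    leaves a linear relation between [x], [y] and 1, whose three coefficients must vanish. *)
Lemma swap_beta (f : {lrmorphism A -> A}) a b : a != 0 -> b != 0 ->
  f d = b *: u -> f u = a *: d ->
  r * s = 1 /\ (gamma != 0 -> a * b = 1).
Proof.
move=> a0 b0 fd fu; have /(congr1 f) := du_rel1.
rewrite rmorphD rmorphB /= !linearZ /= !rmorphM /= fd fu.
rewrite -!(scalerAl, scalerAr) scalerN !scalerA => E.
have iZ k p : evdu (kap k * p) * u = k *: (evdu p * u).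
  by rewrite rmorphM evduC mulr_algl scalerAl.
have [t tE] : {t | t = a * (b * b)} by exists (a * (b * b)).
have key : kap t * sigma' x = kap ((r + s) * t) * x - kap (r * s * t) * sigma x
    + kap (gamma * b) * 1.
  apply/eqP; rewrite -subr_eq0; apply/eqP/(@evdu_dupow_eq0 _ (-1)).
  rewrite /= rmorphB mulrBl [evdu (_ + _)]rmorphD [evdu (_ - _)]rmorphB.
  rewrite [(_ + _) * u]mulrDl [(_ - _) * u]mulrBl !iZ.
  rewrite evdu_sigmaX evduX -u_evdu evduX rmorph1 mul1r mulrA tE E.
  have -> : (r + s) * b * (b * a) = (r + s) * (a * (b * b)) by ring.
  have -> : r * s * b * (a * b) = r * s * (a * (b * b)) by ring.
  by rewrite subrr.
move/(congr1 sigma): key; rewrite !(rmorphD sigma, rmorphN sigma).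
rewrite !(rmorphM sigma) !sigmaC sigma'K rmorph1 sigmaXX => key.
have [|xE yE cE] := @bivariate_linear_eq0 (t * (1 - r * s) * (1 + r * s - s *
  (r + s)))
  (- (t * (r + s) * (1 - r * s)))
  (t * (r + s) * (1 - r * s) * c0 + r * s * t * gamma - gamma * b).
  transitivity (kap t * x - (kap ((r + s) * t) * sigma x
    - kap (r * s * t) * (kap (r + s) * sigma x - kap (r * s) * x + kap gamma)
    + kap (gamma * b) * 1)); last by rewrite key subrr.
  rewrite sigmaX !(rmorphD (bivC R), rmorphB (bivC R), rmorphN (bivC R),
    rmorphM (bivC R), rmorph1 (bivC R)).
  ring.
have t0 : t != 0 by rewrite tE !mulf_neq0.
(* If rs were not 1, the coefficient of [y] would give r = -s and that of [x] would give s^2 = 1,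
   making r a root of unity. *)
have rs : r * s = 1.
  apply/eqP; rewrite eq_sym -subr_eq0; apply/negPn/negP => rs0.
  move/eqP: yE; rewrite oppr_eq0 !mulf_eq0 (negPf t0) (negPf rs0) orbF /=.
  rewrite addr_eq0 => /eqP rE; move/eqP: xE.
  rewrite !mulf_eq0 (negPf t0) (negPf rs0) /= rE addNr mulr0 subr0 mulNr.
  rewrite subr_eq0 => /eqP s2.
  have := @expr_r_neq1 2 isT; rewrite rE sqrrN expr2 -s2; exact/negP/negPn/eqP.
split=> // gamma0; move/eqP: cE.
rewrite rs subrr mulr0 mul0r add0r mul1r.
have -> : t * gamma - gamma * b = gamma * b * (a * b - 1) by rewrite tE; ring.
by rewrite !mulf_eq0 (negPf gamma0) (negPf b0) subr_eq0 => /eqP.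
Qed.

End Structure.

(** * The automorphism groups *)

Section Automorphisms.
Variables (K : fieldType) (alpha beta gamma : K) (A : algType K) (d u : A).
Hypothesis duA : presents_down_up alpha beta gamma d u.

Lemma lrmorph_ext (f g : {lrmorphism A -> A}) :
  f d = g d -> f u = g u -> f =1 g.
Proof.
move=> fd fu; apply: (du_ind duA) => // [c|a b fa fb|a b fa fb].
- by rewrite !linearZ !rmorph1.
- by rewrite !rmorphD /= fa fb.
- by rewrite !rmorphM /= fa fb.
Qed.

Lemma alg_aut_ext (f g : alg_aut A) : f d = g d -> f u = g u -> f = g.
Proof. by move=> fd fu; apply: alg_autP; apply: lrmorph_ext. Qed.

Lemma alg_aut_exists (x y : A) (f g : {lrmorphism A -> A}) :
  f d = x -> f u = y -> g x = d -> g y = u -> f (g d) = d -> f (g u) = u ->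
  exists F : alg_aut A, F d = x /\ F u = y.
Proof.
move=> fd fu gx gy fgd fgu.
have f_bij : bijective f.
  exists g => a.
    by apply: (lrmorph_ext (f := g \o f) (g := idfun)) => /=; rewrite ?fd ?fu.
  by apply: (lrmorph_ext (f := f \o g) (g := idfun)).
by exists (AlgAut f_bij).
Qed.

Lemma scale_aut a b : a != 0 -> b != 0 -> (gamma != 0 -> a * b = 1) ->
  exists F : alg_aut A, F d = a *: d /\ F u = b *: u.
Proof.
have ex a' b' : (gamma != 0 -> a' * b' = 1) ->
    exists f : {lrmorphism A -> A}, f d = a' *: d /\ f u = b' *: u.
  move=> ab1; apply: (du_univ duA); have [rel1 rel2] := du_rel duA.
  (* The cubic terms of each relation rescale alike, so this equation, valid whether or not gamma
     vanishes, is the only constraint. *)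
  have gab : a' * b' * gamma = gamma.
    case: (eqVneq gamma 0) => [->|/ab1 ->]; by rewrite ?mulr0 ?mul1r.
  move: rel1 rel2; rewrite /down_up_relations !expr2 => rel1 rel2.
  split; rewrite -!(scalerAl, scalerAr) !scalerA.
    rewrite rel1 !scalerDr !scalerA.
    have -> : b' * (a' * a') * alpha = alpha * a' * (a' * b') by ring.
    have -> : b' * (a' * a') * beta = beta * b' * (a' * a') by ring.
    by have -> : b' * (a' * a') * gamma = gamma * a' by rewrite -[in RHS]gab;
      ring.
  rewrite rel2 !scalerDr !scalerA.
  have -> : a' * (b' * b') * alpha = alpha * b' * (b' * a') by ring.
  have -> : a' * (b' * b') * beta = beta * (b' * b') * a' by ring.
  by have -> : a' * (b' * b') * gamma = gamma * b' by rewrite -[in RHS]gab;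
    ring.
move=> a0 b0 ab1; have [f [fd fu]] := ex a b ab1.
have [|g [gd gu]] := ex a^-1 b^-1; first by move/ab1 => ab; rewrite -invfM ab
  invr1.
apply: (alg_aut_exists (f := f) (g := g)) => //;
  by rewrite ?gd ?gu !linearZ /= ?gd ?gu ?fd ?fu scalerA ?mulfV ?mulVf ?scale1r.
Qed.

(** With beta = -1 the first relation reads d^2u + ud^2 = alpha dud + gamma d, and exchanging d and
    u gives the second. *)
Lemma swap_aut : beta = -1 -> exists F : alg_aut A, F d = u /\ F u = d.
Proof.
move=> beta1; have [rel1 rel2] := du_rel duA.
have [|f [fd fu]] := du_univ duA (x := u) (y := d).
  rewrite beta1 !scaleN1r in rel1 rel2; split; rewrite beta1 scaleN1r.
    by rewrite rel2 opprD addrA subrK opprB addrC subrK.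
  by rewrite rel1 opprD addrA subrK opprB addrC subrK.
by apply: (alg_aut_exists (f := f) (g := f)); rewrite ?fd ?fu.
Qed.

(** An automorphism is determined by the images of d and u, so a group that parametrizes the
    possible pairs of images compatibly with composition is the automorphism group. *)
Lemma alg_aut_group (G : groupType) (dx ux : G -> A) :
  (forall x, exists F : alg_aut A, F d = dx x /\ F u = ux x) ->
  (forall x y (F : alg_aut A), F d = dx x -> F u = ux x ->
     F (dx y) = dx (x * y)%g /\ F (ux y) = ux (x * y)%g) ->
  (forall x y, dx x = dx y -> ux x = ux y -> x = y) ->
  (forall F : alg_aut A, exists x, F d = dx x /\ F u = ux x) ->
  exists2 phi : {multiplicative G -> alg_aut A}, bijective phi &
    forall x, phi x d = dx x /\ phi x u = ux x.
Proof.
move=> ex mul inj surj.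
pose phi x := projT1 (cid (ex x)).
have phiE x : phi x d = dx x /\ phi x u = ux x := projT2 (cid (ex x)).
have phiM : {morph phi : x y / (x * y)%g}.
  move=> x y; have [phid phiu] := phiE x; have [yd yu] := phiE y.
  have [xyd xyu] := mul x y _ phid phiu; have [phixyd phixyu] := phiE (x * y)%g.
  by apply: alg_aut_ext; rewrite alg_autM ?yd ?yu ?xyd ?xyu.
pose phi' : {multiplicative G -> alg_aut A} :=
  HB.pack phi (monoid.isMultiplicative.Build G (alg_aut A) phi phiM).
exists phi' => //.
pose psi (F : alg_aut A) := projT1 (cid (surj F)).
have psiE (F : alg_aut A) : F d = dx (psi F) /\ F u = ux (psi F) := projT2 (cid
  (surj F)).
exists psi => [x|F] /=.
  by have [xd xu] := phiE x; have [pd pu] := psiE (phi x);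
    apply: inj; rewrite -?pd -?pu.
by have [xd xu] := phiE (psi F); have [pd pu] := psiE F;
  apply: alg_aut_ext; rewrite ?xd ?xu.
Qed.

End Automorphisms.

(** * Tori and their extensions by the swap *)

Section Cases.
Variables (K : fieldType) (r s gamma : K) (A : algType K) (d u : A).
Hypotheses (r_neq0 : r != 0) (s_neq0 : s != 0).
Hypothesis r_not_root : ~ is_root_of_unity r.
Hypothesis duA : presents_down_up (r + s) (- (r * s)) gamma d u.

Let c0 := gamma / (r - 1).

Fact gamma_c0 : gamma + c0 = r * c0.
Proof.
have r1 : r - 1 != 0 by rewrite subr_eq0 -[r]expr1 (expr_r_neq1 r_not_root).
by rewrite /c0; field.
Qed.

Lemma alg_aut_cases (F : alg_aut A) : exists a b, [/\ a != 0, b != 0,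
  gamma != 0 -> a * b = 1 &
  (F d = a *: d /\ F u = b *: u) \/
  [/\ - (r * s) = -1, F d = b *: u & F u = a *: d]].
Proof.
have [a [b [a0 b0 cases]]] := aut_generators (poly2_bivariate K) r_neq0 s_neq0
  r_not_root gamma_c0 duA (alg_autK F) (alg_autVK F).
exists a, b; case: cases => [[Fd Fu]|[Fd Fu]].
  split=> //; last by left.
  by move=> g0; apply: (diag_gamma (poly2_bivariate K) r_neq0 s_neq0
    gamma_c0 duA a0 Fd Fu g0).
have [rs ab] := swap_beta (poly2_bivariate K) r_neq0 s_neq0
  r_not_root gamma_c0 duA a0 b0 Fd Fu.
by split=> //; right; rewrite rs.
Qed.

(** [w1] and [w2] are the characters by which N scales d and u; together they identify N with the
    admissible pairs of scalars. The two projections of the 2-torus and the pair of identity and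
    inversion on the 1-torus both fit. *)
Variables (N : groupType) (w1 w2 : N -> K).
Hypotheses (w1_neq0 : forall n, w1 n != 0) (w2_neq0 : forall n, w2 n != 0).
Hypotheses (w1M : forall n m, w1 (n * m)%g = w1 n * w1 m)
  (w2M : forall n m, w2 (n * m)%g = w2 n * w2 m).
Hypothesis w_inj : forall n m, w1 n = w1 m -> w2 n = w2 m -> n = m.
Hypothesis w_gamma : forall n, gamma != 0 -> w1 n * w2 n = 1.
Hypothesis w_surj : forall a b, a != 0 -> b != 0 ->
  (gamma != 0 -> a * b = 1) -> exists n, w1 n = a /\ w2 n = b.

Let dn0 : d != 0.
Proof. exact: (d_neq0 (poly2_bivariate K) r_neq0 s_neq0 gamma_c0 duA). Qed.
Let un0 : u != 0.
Proof. exact: (u_neq0 (poly2_bivariate K) r_neq0 s_neq0 gamma_c0 duA). Qed.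
Let indep a b : a *: d = b *: u -> a = 0.
Proof. exact: (d_u_indep (poly2_bivariate K) r_neq0 s_neq0 r_not_root gamma_c0
  duA). Qed.

Let scaler_injl (a b : K) (z : A) : z != 0 -> a *: z = b *: z -> a = b.
Proof.
move=> z0 /eqP; rewrite -subr_eq0 -scalerBl scaler_eq0 subr_eq0 (negPf z0) orbF.
by move/eqP.
Qed.

Lemma torus_case : - (r * s) <> -1 ->
  exists2 phi : {multiplicative N -> alg_aut A}, bijective phi &
    forall n, phi n d = w1 n *: d /\ phi n u = w2 n *: u.
Proof.
move=> beta1; apply: (alg_aut_group duA).
- by move=> n; apply: (scale_aut duA) => //; apply: w_gamma.
- move=> n m F Fd Fu; rewrite !linearZ /= Fd Fu !scalerA w1M w2M.
  by rewrite mulrC [w2 m * _]mulrC.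
- by move=> n m /scaler_injl-/(_ dn0) E1 /scaler_injl-/(_ un0); apply: w_inj.
- move=> F; have [a [b [a0 b0 ab [[Fd Fu]|[/beta1//]]]]] := alg_aut_cases F.
  have [n [na nb]] := w_surj a0 b0 ab.
  by exists n; rewrite Fd Fu na nb.
Qed.

Variable iota : N -> N.
Hypothesis iotaM : {morph iota : x y / (x * y)%g}.
Hypothesis iotaK : involutive iota.
Hypothesis w1_iota : forall n, w1 (iota n) = w2 n.

Let w2_iota n : w2 (iota n) = w1 n.
Proof. by rewrite -w1_iota iotaK. Qed.

Local Notation G := (semidirect (invol_action iotaM iotaK)).

Lemma semidirect_case : - (r * s) = -1 ->
  exists2 phi : {multiplicative G -> alg_aut A}, bijective phi &
    (forall n, phi (sd_inl _ n) d = w1 n *: d /\ phi (sd_inl _ n) u = w2 n *: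
      u) /\
    (phi (sd_inr _ (1%R : 'Z_2)) d = u /\ phi (sd_inr _ (1%R : 'Z_2)) u = d).
Proof.
move=> beta1.
(* The pair (n, h) acts as the swap when h = 1, followed by n; hence d then goes to the image of u
   under n. *)
pose dx (x : G) := if sd_compl x == 0 then w1 (sd_normal x) *: d
                   else w2 (sd_normal x) *: u.
pose ux (x : G) := if sd_compl x == 0 then w2 (sd_normal x) *: u
                   else w1 (sd_normal x) *: d.
have w1_1 : w1 1%g = 1.
  by apply: (mulfI (w1_neq0 1%g)); rewrite -w1M mulg1 mulr1.
have w2_1 : w2 1%g = 1.
  by apply: (mulfI (w2_neq0 1%g)); rewrite -w2M mulg1 mulr1.
have Z2 (h : 'Z_2) : h = 0 \/ h = 1.
  by case: h => [[|[|//]] i]; [left | right]; apply: val_inj.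
suff [phi phi_bij phiE] : exists2 phi : {multiplicative G -> alg_aut A},
    bijective phi & forall x, phi x d = dx x /\ phi x u = ux x.
  exists phi => //; split=> [n|]; rewrite !(phiE _).1 !(phiE _).2 //.
  by rewrite /dx /ux /= w1_1 w2_1 !scale1r.
apply: (alg_aut_group duA).
- move=> [n h]; rewrite /dx /ux /=.
  have [F [Fd Fu]] := scale_aut duA (w1_neq0 n) (w2_neq0 n) (@w_gamma n).
  case: ifP => _; first by exists F.
  have [S [Sd Su]] := swap_aut duA beta1.
  by exists (F * S)%g; rewrite !alg_autM Sd Su.
- move=> [n h] [m k] F; rewrite /dx /ux /=.
  by case: (Z2 h) => ->; case: (Z2 k) => -> /= Fd Fu; rewrite !linearZ /=
    ?Fd ?Fu !scalerA !w1M !w2M /invol_fun /= ?w1_iota ?w2_iota mulrC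
    [X in _ /\ X *: _ = _]mulrC.
- move=> [n h] [m k]; rewrite /dx /ux /=.
  case: (Z2 h) => ->; case: (Z2 k) => -> /= E1 E2.
  + congr Semidirect; apply: w_inj; [exact: scaler_injl E1 | exact: scaler_injl
    E2].
  + by have := w1_neq0 n; rewrite (indep E1) eqxx.
  + by have := w1_neq0 n; rewrite (indep E2) eqxx.
  + congr Semidirect; apply: w_inj; [exact: scaler_injl E2 | exact: scaler_injl
    E1].
- move=> F; have [a [b [a0 b0 ab cases]]] := alg_aut_cases F.
  have [n [na nb]] := w_surj a0 b0 ab.
  case: cases => [[Fd Fu]|[_ Fd Fu]].
    by exists (Semidirect _ n (0%R : 'Z_2)); rewrite /dx /ux /= na nb.
  by exists (Semidirect _ n (1%R : 'Z_2)); rewrite /dx /ux /= na nb.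
Qed.

End Cases.

Theorem theorem3p1 (K : closedFieldType) (charK0 : [pchar K] =i pred0)
    (r s gamma alpha beta : K)
    (def_alpha : alpha = r + s) (def_beta : beta = - (r * s))
    (beta_neq0 : beta != 0)
    (rs_not_root : ~ is_root_of_unity r \/ ~ is_root_of_unity s) :
  let A := down_up alpha beta gamma in
  let d : A := down_up_d alpha beta gamma in
  let u : A := down_up_u alpha beta gamma in
  [/\ (gamma = 0 -> beta = -1 ->
        exists2 phi : {multiplicative semidirect (swap_action K) -> alg_aut A},
          bijective phi &
          (forall lambda mu : nonzero K,
             phi (sd_inl (swap_action K) (lambda, mu)) d = nonzero_val lambda *: d /\
             phi (sd_inl (swap_action K) (lambda, mu)) u = nonzero_val mu *: u) /\
          (phi (sd_inr (swap_action K) (1%R : 'Z_2)) d = u /\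
           phi (sd_inr (swap_action K) (1%R : 'Z_2)) u = d)),
      (gamma = 0 -> beta <> -1 ->
        exists2 phi : {multiplicative (nonzero K * nonzero K) -> alg_aut A},
          bijective phi &
          forall lambda mu : nonzero K,
            phi (lambda, mu) d = nonzero_val lambda *: d /\
            phi (lambda, mu) u = nonzero_val mu *: u),
      (gamma <> 0 -> beta = -1 ->
        exists2 phi : {multiplicative semidirect (inv_action K) -> alg_aut A},
          bijective phi &
          (forall mu : nonzero K,
             phi (sd_inl (inv_action K) mu) d = nonzero_val mu *: d /\
             phi (sd_inl (inv_action K) mu) u = (nonzero_val mu)^-1 *: u) /\
          (phi (sd_inr (inv_action K) (1%R : 'Z_2)) d = u /\
           phi (sd_inr (inv_action K) (1%R : 'Z_2)) u = d)) &
      (gamma <> 0 -> beta <> -1 ->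
        exists2 phi : {multiplicative nonzero K -> alg_aut A},
          bijective phi &
          forall mu : nonzero K,
            phi mu d = nonzero_val mu *: d /\
            phi mu u = (nonzero_val mu)^-1 *: u)].
Proof.
move=> A d u.
(* Both alpha and beta are symmetric in r and s, and the conclusion mentions only alpha, beta and
   gamma. *)
wlog r_not_root : r s def_alpha def_beta rs_not_root / ~ is_root_of_unity r.
  case: (rs_not_root) => [rn|sn] core; first exact: core def_alpha def_beta _
    rn.
  apply: (core s r) sn; [by rewrite addrC | by rewrite mulrC | by case:
    rs_not_root; [right | left]].
have /andP[r_neq0 s_neq0] : (r != 0) && (s != 0).
  by rewrite -negb_or -mulf_eq0 -oppr_eq0 -def_beta.
have duA : presents_down_up (r + s) (- (r * s)) gamma d u.
  by rewrite -def_alpha -def_beta; exact: down_up_presented.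
have nz (a : K) : a != 0 -> exists n : nonzero K, nonzero_val n = a.
  by move=> a0; exists (Nonzero a0).
have torus2 a b : a != 0 -> b != 0 -> (gamma != 0 -> a * b = 1) ->
    exists n : nonzero K * nonzero K,
      nonzero_val n.1 = a /\ nonzero_val n.2 = b.
  by move=> /nz[n <-] /nz[m <-] _; exists (n, m).
have torus2_inj (n m : nonzero K * nonzero K) :
    nonzero_val n.1 = nonzero_val m.1 ->
    nonzero_val n.2 = nonzero_val m.2 -> n = m.
  by case: n m => [n1 n2] [m1 m2] /= /val_inj -> /val_inj ->.
(* For nonzero gamma the condition ab = 1 makes b the inverse of a, so the admissible pairs form a
   1-torus. *)
have torus1 a b : gamma <> 0 -> a != 0 -> b != 0 -> (gamma != 0 -> a * b = 1) ->
    exists n : nonzero K, nonzero_val n = a /\ (nonzero_val n)^-1 = b.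
  move=> /eqP g0 a0 _ /(_ g0) ab; have [n nE] := nz a a0; exists n; split=> //.
  by apply: (mulfI a0); rewrite nE mulfV // ab.
have valN (n : nonzero K) := nonzero_valP n.
have valVN (n : nonzero K) : (nonzero_val n)^-1 != 0 by rewrite invr_eq0.
split=> [gamma0 beta1|gamma0 beta1|gamma0 beta1|gamma0 beta1];
  rewrite def_beta in beta1.
- have gF (n : nonzero K * nonzero K) :
      gamma != 0 -> nonzero_val n.1 * nonzero_val n.2 = 1.
    by rewrite gamma0 eqxx.
  have [phi phi_bij [phiN phiS]] := semidirect_case r_neq0 s_neq0 r_not_root duA
    (fun n => valN n.1) (fun n => valN n.2) (fun _ _ => erefl) (fun _ _ =>
      erefl)
    torus2_inj gF torus2 (@torus_swapM K) (@torus_swapK K) (fun _ => erefl)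
      beta1.
  by exists phi => //; split=> // lambda mu; exact: phiN (lambda, mu).
- have gF (n : nonzero K * nonzero K) :
      gamma != 0 -> nonzero_val n.1 * nonzero_val n.2 = 1.
    by rewrite gamma0 eqxx.
  have [phi phi_bij phiE] := torus_case r_neq0 s_neq0 r_not_root duA
    (fun n => valN n.1) (fun n => valN n.2) (fun _ _ => erefl) (fun _ _ =>
      erefl)
    torus2_inj gF torus2 beta1.
  by exists phi => // lambda mu; exact: phiE (lambda, mu).
- have gF (n : nonzero K) :
      gamma != 0 -> nonzero_val n * (nonzero_val n)^-1 = 1.
    by move=> _; rewrite mulfV.
  have [phi phi_bij [phiN phiS]] := semidirect_case r_neq0 s_neq0 r_not_root duA
    valN valVN (fun _ _ => erefl) (fun _ _ => invfM _ _)
    (fun n m E _ => val_inj E) gF (fun a b => torus1 a b gamma0)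
    (@nonzero_invM K) (@invgK (nonzero K)) (fun _ => erefl) beta1.
  by exists phi.
- have gF (n : nonzero K) :
      gamma != 0 -> nonzero_val n * (nonzero_val n)^-1 = 1.
    by move=> _; rewrite mulfV.
  have [phi phi_bij phiE] := torus_case r_neq0 s_neq0 r_not_root duA
    valN valVN (fun _ _ => erefl) (fun _ _ => invfM _ _)
    (fun n m E _ => val_inj E) gF (fun a b => torus1 a b gamma0) beta1.
  by exists phi.
Qed.
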